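(* Let $\Omega,\Omega_\xi\subset\mathbb{R}^3$ be open domains, $0<T\le\infty$, and let $\varphi:\Omega\times[0,T)\to\Omega_\xi$ be a smooth motion such that for each $t\in[0,T)$ the map $\varphi(\cdot,t):\Omega\to\Omega_\xi$ is a smooth diffeomorphism with $\det \mathrm{D}\varphi(x,t)>0$. Let $v(\xi,t)$ denote its spatial velocity, $v(\varphi(x,t),t)=\partial_t\varphi(x,t)$. Let $f:\Omega_\xi\times[0,T)\to\mathbb{R}^3$ be a smooth body force, let $\sigma:\Omega_\xi\times[0,T)\to\mathrm{Sym}(3)$ be smooth, and let $\mathbb{H}:\mathrm{Sym}(3)\to\mathrm{Lin}(\mathrm{Sym}(3),\mathrm{Sym}(3))$ be smooth. Assume the initial equilibrium $\mathrm{Div}_\xi\,\sigma(\xi,0)=f(\xi,0)$ for all $\xi\in\Omega_\xi$. Then $(\sigma,v)$ satisfies the system $$\frac{\mathrm{D}^{\mathrm{ZJ}}}{\mathrm{D}t}[\sigma]=\mathbb{H}(\sigma).D,\qquad \mathrm{Div}_\xi\,\sigma(\xi,t)=f(\xi,t)\qquad\text{in }\Omega_\xi\times[0,T)$$ if and only if it satisfies the system $$\partial_t\sigma+\mathrm{D}_\xi\sigma.v+\sigma W-W\sigma=\mathbb{H}(\sigma).\mathrm{sym}\,\mathrm{D}_\xi v,$$ $$\mathrm{Div}_\xi[\mathbb{H}(\sigma).\mathrm{sym}\,\mathrm{D}_\xi v]=\mathrm{Div}_\xi\big[\sigma(\mathrm{D}_\xi v)^T-(\mathrm{div}_\xi v)\,\sigma+\sigma\,(\mathrm{skew}\,\mathrm{D}_\xi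 v)-(\mathrm{skew}\,\mathrm{D}_\xi v)\,\sigma\big]+(\mathrm{div}_\xi v)\,f+\mathrm{D}_\xi f.v+\partial_t f$$ in $\Omega_\xi\times[0,T)$.
   Context: $\mathrm{Sym}(3)$ is the space of real symmetric $3\times3$ matrices. $\mathrm{D}_\xi v$ is the Jacobian matrix of $v(\cdot,t)$; $D=\mathrm{sym}\,\mathrm{D}_\xi v$ and $W=\mathrm{skew}\,\mathrm{D}_\xi v$, with $\mathrm{sym}\,X=\frac12(X+X^T)$, $\mathrm{skew}\,X=\frac12(X-X^T)$. For a matrix field $A$, $\mathrm{Div}_\xi A$ is the vector field obtained by taking the divergence of each row; $\mathrm{div}_\xi v=\sum_{i=1}^3\partial_{\xi_i}v_i$. $\mathrm{D}_\xi\sigma.v=\sum_i v_i\,\partial_{\xi_i}\sigma$ and $\mathrm{D}_\xi f.v=\sum_i v_i\,\partial_{\xi_i}f$. The material derivative of a spatial field $q(\xi,t)$ is $\frac{\mathrm{D}}{\mathrm{D}t}[q]=\partial_t q+\mathrm{D}_\xi q.v$, and the Zaremba-Jaumann rate of $\sigma$ is $\frac{\mathrm{D}^{\mathrm{ZJ}}}{\mathrm{D}t}[\sigma]=\frac{\mathrm{D}}{\mathrm{D}t}[\sigma]+\sigma W-W\sigma$. The current configuration is assumed fixed in time: $\varphi(\Omega,t)=\Omega_\xi$ for all $t$. The notation $\mathbb{H}(\sigma).D$ means the linear map $\mathbb{H}(\sigma)$ applied to $D$. *)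

(* Defs.v *)
From HB Require Import structures.
From mathcomp Require Import all_boot all_order all_algebra.
From mathcomp Require Import sesquilinear.
From mathcomp Require Import all_classical all_reals all_analysis.
Set Implicit Arguments.
Unset Strict Implicit.
Unset Printing Implicit Defensive.
Import Order.TTheory GRing.Theory Num.Theory.
Import numFieldNormedType.Exports.
Local Open Scope classical_set_scope.
Local Open Scope ring_scope.

Section Smoothness.
Context {R : realType} {V W : normedModType R}.
Implicit Types (D L : set V) (g : V -> W) (x u : V) (k : nat).

(* Directional derivative of g at x along u, the increments being restricted
   to the h such that h *: u + x stays in D.  At an interior point of D this is
   the ordinary directional derivative; at a boundary point such as t = 0 in
   `[0, T[ it is the one-sided derivative. *)
Definition derivable_in D g x u : Prop :=
  cvg ((fun h : R => h^-1 *: (g (h *: u + x) - g x)) @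
         within [set h : R | D (h *: u + x)] 0^').

Definition derive_in D g x u : W :=
  lim ((fun h : R => h^-1 *: (g (h *: u + x) - g x)) @
         within [set h : R | D (h *: u + x)] 0^').

(* L is the space of directions in which one differentiates: everything for
   an open set or for Omega x [0, T), and Sym(3) itself for the domain
   Sym(3), which has empty interior in the space of all 3 x 3 matrices. *)
Fixpoint Ck_in D L k g : Prop :=
  {within D, continuous g} /\
  match k with
  | 0%N => True
  | k'.+1 => forall u, L u ->
      (forall x, D x -> derivable_in D g x u) /\
      Ck_in D L k' (fun x => derive_in D g x u)
  end.

Definition smooth_in D L g : Prop := forall k, Ck_in D L k g.

End Smoothness.

Section Kinematics.
Context {R : realType}.
Notation V3 := 'cV[R]_3.
Notation M3 := 'M[R]_3.

Definition is_domain (A : set V3) : Prop := [/\ open A, connected A & A !=set0].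

Definition Sym3 : set M3 := [set A | A \is symmetricmx].

Definition time_interval (T : \bar R) : set R :=
  [set t | 0 <= t /\ (t%:E < T)%E].

Definition smooth_spacetime {W : normedModType R} (A : set V3) (T : \bar R)
    (q : V3 -> R -> W) : Prop :=
  smooth_in (A `*` time_interval T) [set: V3 * R] (fun p => q p.1 p.2).

Definition diffeomorphism (A B : set V3) (g : V3 -> V3) : Prop :=
  smooth_in A [set: V3] g /\
  exists g' : V3 -> V3,
    [/\ smooth_in B [set: V3] g',
        forall x, A x -> B (g x) /\ g' (g x) = x &
        forall y, B y -> A (g' y) /\ g (g' y) = y].

(* H : Sym(3) -> Lin(Sym(3), Sym(3)), represented by a total function of which
   only the values H S B with S and B symmetric matter. *)
Definition Lin_Sym3_valued (H : M3 -> M3 -> M3) : Prop :=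
  forall S, Sym3 S ->
    (forall B, Sym3 B -> Sym3 (H S B)) /\
    (forall (a : R) B C, Sym3 B -> Sym3 C ->
       H S (a *: B + C) = a *: H S B + H S C).

(* Lin(Sym(3), Sym(3)) being finite-dimensional, smoothness of H is smoothness
   of S |-> H S B for every B in Sym(3). *)
Definition smooth_Lin_Sym3 (H : M3 -> M3 -> M3) : Prop :=
  forall B, Sym3 B -> smooth_in Sym3 Sym3 (fun S => H S B).

Definition e3 (i : 'I_3) : V3 := delta_mx i 0.

Definition sym_part (X : M3) : M3 := 2^-1 *: (X + X^T).
Definition skew_part (X : M3) : M3 := 2^-1 *: (X - X^T).

Definition Jac (u : V3 -> V3) (x : V3) : M3 :=
  \matrix_(i, j) 'D_(e3 j) (fun y => u y i 0) x.

Definition div (u : V3 -> V3) (x : V3) : R :=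
  \sum_i 'D_(e3 i) (fun y => u y i 0) x.

Definition Div (A : V3 -> M3) (x : V3) : V3 :=
  \col_i div (fun y => (row i (A y))^T) x.

Definition convect {W : normedModType R} (q : V3 -> W) (w x : V3) : W :=
  \sum_i w i 0 *: 'D_(e3 i) q x.

Definition dt {W : normedModType R} (T : \bar R) (q : V3 -> R -> W)
    (x : V3) (t : R) : W :=
  derive_in (time_interval T) (q x) t 1.

Definition material {W : normedModType R} (T : \bar R) (v : V3 -> R -> V3)
    (q : V3 -> R -> W) (xi : V3) (t : R) : W :=
  dt T q xi t + convect (q ^~ t) (v xi t) xi.

Definition ZJ_rate (T : \bar R) (v : V3 -> R -> V3) (sigma : V3 -> R -> M3)
    (xi : V3) (t : R) : M3 :=
  let W := skew_part (Jac (v ^~ t) xi) in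
  material T v sigma xi t + sigma xi t *m W - W *m sigma xi t.

End Kinematics.

(* Main.v *)
(** Write [S = Div sigma] and [L = D v].  Since partial derivatives commute, the
    divergence of the left-hand side of the rate equation is
      [Div (sigma L^T - (div v) sigma + sigma W - W sigma)
        + d_t S + D S . v + (div v) S],
    so, given the rate equation, the second equation of the second system says
    that [r = S - f] solves the continuity equation
      [d_t r + D r . v + (div v) r = 0].
    This is clear if [r = 0].  Conversely, along a trajectory
    [d_t (det D phi) = (div v) (det D phi)], hence
    [det D phi (x, t) * r (phi (x, t), t)] does not depend on [t]; it vanishes at
    [t = 0], and trajectories fill [Omega_xi] at every time.

    The velocity is not assumed smooth, but for fixed [t] it is [d_t phi]
    composed with the inverse of [phi ^~ t].  The equations are also required at
    [t = 0], where time derivatives are one-sided; the exchange of [d_t] and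
    [d_j] is therefore proved by the mean value theorem on squares having the
    point as a corner. *)
Require Import Defs.
From HB Require Import structures.
From mathcomp Require Import all_boot all_order all_algebra.
From mathcomp Require Import all_classical all_reals all_analysis.
From mathcomp Require Import ring.
Set Implicit Arguments.
Unset Strict Implicit.
Unset Printing Implicit Defensive.
Import Order.TTheory GRing.Theory Num.Theory.
Import numFieldNormedType.Exports.
Local Open Scope classical_set_scope.
Local Open Scope ring_scope.

(** * One-sided derivatives *)

(** The filter underlying [derivable_in] and [derive_in]. It may be improper, so a limit along it
    identifies [derive_in] only once [ProperFilter] is known. *)
Notation admissible D x u := (within [set h | D (h *: u + x)] 0^').

Section OneSided.
Context {R : realType} {V W : normedModType R}.
Implicit Types (D L : set V) (f g : V -> W) (x u : V) (k : nat).

Lemma near_line x u (P : set V) :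
  nbhs x P -> \forall h \near (0 : R), P (h *: u + x).
Proof.
move=> xP.
have : (fun h : R => h *: u + x) @ 0 --> x.
  rewrite -[X in _ --> X]add0r -[X in _ --> X + _](scale0r u).
  by apply: cvgD; [exact: scalel_continuous|exact: cvg_cst].
exact.
Qed.

(** Near an interior point every small increment stays in [D], so the restriction is void. Having an
    equality of filters lets one-sided derivatives be rewritten into ['D_u]. *)
Lemma admissible_interior D x u : nbhs x D -> admissible D x u = (0 : R)^'.
Proof.
move=> xD; rewrite eqEsubset; split=> P; last exact: cvg_within.
move=> PD; have nD := near_line u xD.
suff: \forall h \near (0 : R), h != 0 -> P h by [].
near=> h => h0.
have : h != 0 -> D (h *: u + x) -> P h.
  by near: h; exact: PD.
apply=> //; near: h; exact: nD.
Unshelve. all: by end_near. Qed.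

Lemma derive_in_interior D g x u : nbhs x D -> derive_in D g x u = 'D_u g x.
Proof. by move=> xD; rewrite /derive_in admissible_interior. Qed.

Lemma derivable_in_interior D g x u :
  nbhs x D -> derivable_in D g x u = derivable g x u.
Proof. by move=> xD; rewrite /derivable_in admissible_interior. Qed.

Lemma fmap_eq_within (S T : Type) (A : set S) (F : set_system S)
    (p q : S -> T) : {in A, p =1 q} -> p @ within A F = q @ within A F.
Proof.
move=> pq; rewrite /fmap funeqE => P /=.
rewrite /within/=; congr F; apply/seteqP; split=> s /= + As => /(_ As);
  by rewrite pq// inE.
Qed.

Section congr.
Variables (D : set V) (f g : V -> W).
Hypothesis fg : {in D, f =1 g}.

Let quotient_eq x u : D x ->
  ((fun h : R => h^-1 *: (f (h *: u + x) - f x)) @ admissible D x u) =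
  ((fun h : R => h^-1 *: (g (h *: u + x) - g x)) @ admissible D x u).
Proof.
by move=> Dx; apply: fmap_eq_within => h; rewrite inE /= => Dh; rewrite !fg ?inE.
Qed.

Lemma derive_in_eq x u : D x -> derive_in D f x u = derive_in D g x u.
Proof. by move=> Dx; rewrite /derive_in quotient_eq. Qed.

Lemma derivable_in_eq x u : D x -> derivable_in D f x u = derivable_in D g x u.
Proof. by move=> Dx; rewrite /derivable_in quotient_eq. Qed.

End congr.

(** Difference quotients at points of [D] only see values on [D], so the derivatives again agree on
    [D] and the induction continues. This is how a function is replaced by a formula valid only on
    [D]. *)
Lemma Ck_in_eq D L k f g :
  {in D, f =1 g} -> Ck_in D L k f -> Ck_in D L k g.
Proof.
have within_eq f' g' : {in D, f' =1 g'} -> {within D, continuous f'} ->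
    {within D, continuous g'}.
  by move=> fg'; exact: (@subspace_eq_continuous V D W f' g' fg').
elim: k f g => [|k IH] f g fg [cf kf]; first by split=> //; exact: within_eq cf.
split; [exact: within_eq cf | move=> u Lu]; have [df ck] := kf u Lu; split.
  by move=> x Dx; rewrite -(derivable_in_eq fg)//; exact: df.
by apply: IH ck => x; rewrite inE => Dx; exact: derive_in_eq.
Qed.

Lemma Ck_inW D L k f : Ck_in D L k.+1 f -> Ck_in D L k f.
Proof.
elim: k f => [|k IH] f [cf kf]; split => // u Lu.
by have [df ck] := kf u Lu; split => //; exact: IH.
Qed.

End OneSided.

(** * Components of matrix-valued maps *)

Section Coordinates.
Context {R : realType} {V : normedModType R} {m n : nat}.
Implicit Types (D L : set V) (g : V -> 'M[R]_(m, n)).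

(** Coordinates are continuous, so the quotients converge entrywise; properness of the filter makes
    the limit unique. *)
Lemma derive_in_coord D g x u i j :
  ProperFilter (admissible D x u) -> derivable_in D g x u ->
  derivable_in D (fun y => g y i j) x u /\
  derive_in D (fun y => g y i j) x u = derive_in D g x u i j.
Proof.
move=> FF /cvg_ex[/= l gl].
have gl' : h^-1 *: (g (h *: u + x) i j - g x i j) @[h --> admissible D x u]
    --> l i j.
  have := cvg_comp _ _ gl (@coord_continuous _ _ _ i j l).
  by apply: cvg_trans; apply: near_eq_cvg; near=> h => /=; rewrite !mxE.
split; first by apply/cvg_ex; exists (l i j).
by rewrite /derive_in (cvg_lim _ gl')// (cvg_lim _ gl).
Unshelve. all: by end_near. Qed.

Lemma Ck_in_coord D L k g i j :
  (forall x u, D x -> L u -> ProperFilter (admissible D x u)) ->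
  Ck_in D L k g -> Ck_in D L k (fun y => g y i j).
Proof.
move=> DP; have within_coord g' : {within D, continuous g'} ->
    {within D, continuous (fun y => g' y i j)}.
  move=> /subspace_continuousP cg; apply/subspace_continuousP => x Dx.
  exact: (cvg_comp _ _ (cg x Dx) (@coord_continuous _ _ _ i j (g' x))).
elim: k g => [|k IH] g [cg dg]; first by split=> //; exact: within_coord.
split; [exact: within_coord|move=> u Lu]; have [dgu cgu] := dg u Lu; split.
  by move=> x Dx; apply: (derive_in_coord i j (DP _ _ Dx Lu) (dgu x Dx)).1.
apply: Ck_in_eq (IH _ cgu) => x; rewrite inE => Dx.
by rewrite (derive_in_coord i j (DP _ _ Dx Lu) (dgu x Dx)).2.
Qed.

End Coordinates.

Lemma open_admissible_proper {R : realType} {V : normedModType R}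
    (A : set V) x u : open A -> A x -> ProperFilter (admissible A x u).
Proof.
move=> oA Ax; rewrite (admissible_interior _ (open_nbhs_nbhs (conj oA Ax))).
exact: Proper_dnbhs_numFieldType.
Qed.

(** * Slices of spacetime at a fixed time and at a fixed position *)

Section Spacetime.
Context {R : realType} {W : normedModType R} (A : set 'cV[R]_3) (T : \bar R).
Notation I := (time_interval T).
Implicit Types (g : 'cV[R]_3 * R -> W) (x u : 'cV[R]_3) (t s : R).

Lemma nbhs_lt_ereal t : (t%:E < T)%E -> \forall r \near t, (r%:E < T)%E.
Proof.
case: T => [a| |] //=; last by move=> _; near=> r; exact: ltry.
by rewrite lte_fin => /lt_nbhsl; apply: filterS => r; rewrite lte_fin.
Unshelve. all: by end_near. Qed.

(** At [t = 0] an increment must satisfy [h * s >= 0]; since [h] may have either sign, arbitrarily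
    small nonzero ones exist. *)
Lemma spacetime_admissible_proper x t u s : open A -> A x -> I t ->
  ProperFilter (admissible (A `*` I) (x, t) (u, s)).
Proof.
move=> oA Ax [t0 tT]; apply: Build_ProperFilter.
rewrite /within /dnbhs /within /= => F0.
have F1 : \forall h \near (0 : R), h != 0 ->
    ~ (A `*` I) (h *: (u, s) + (x, t)) by [].
have nA := near_line u (open_nbhs_nbhs (conj oA Ax)).
have nT := near_line s (nbhs_lt_ereal tT).
have [e /= e0 He] := (nbhs_ballP _ _).1 (filterI F1 (filterI nA nT)).
(* [h] takes the sign of [s], which keeps the time nonnegative; its size [e / 2] stays inside the
   ball. *)
pose h := (if 0 <= s then 1 else -1) * (e / 2).
have e20 : 0 < e / 2 by rewrite divr_gt0.
have nh : `|h| = e / 2.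
  by rewrite /h; case: ifP => _; rewrite ?mul1r ?mulN1r ?normrN gtr0_norm.
have : ball 0 e h.
  by rewrite /ball /= sub0r normrN nh ltr_pdivrMr// ltr_pMr// ltr1n.
move=> /He[+ [hA hT]]; apply; first by rewrite -normr_gt0 nh.
split => //; split=> //=; rewrite addr_ge0//; change (0 <= h * s).
rewrite /h; case: ifP => [s0|/negbT]; first by rewrite mul1r mulr_ge0// ltW.
rewrite -ltNge => s0;
  by rewrite mulN1r mulNr -mulrN mulr_ge0 ?oppr_ge0// ltW.
Qed.

Lemma line_space x t u h :
  h *: ((u, 0) : 'cV[R]_3 * R) + (x, t) = (h *: u + x, t).
Proof. by congr pair; rewrite /= scaler0 add0r. Qed.

Lemma line_time x t h :
  h *: ((0, 1) : 'cV[R]_3 * R) + (x, t) = (x, h *: 1 + t).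
Proof. by congr pair; rewrite /= scaler0 add0r. Qed.

Lemma admissible_space x t u : I t ->
  admissible (A `*` I) (x, t) (u, 0) = admissible A x u.
Proof.
move=> It; rewrite (_ : [set h | _] = [set h | A (h *: u + x)])//.
by apply/seteqP; split=> h; rewrite /mkset line_space => // -[].
Qed.

Let quotient_space g x t u h :
  h^-1 *: (g (h *: (u, 0) + (x, t)) - g (x, t)) =
  h^-1 *: (g (h *: u + x, t) - g (x, t)).
Proof. by rewrite line_space. Qed.

Lemma derive_in_space g x t u : I t ->
  derive_in (A `*` I) g (x, t) (u, 0) = derive_in A (fun y => g (y, t)) x u.
Proof.
move=> It; rewrite /derive_in admissible_space//.
by rewrite (funext (quotient_space _ _ _ _)).
Qed.

Lemma derivable_in_space g x t u : I t ->
  derivable_in (A `*` I) g (x, t) (u, 0) =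
  derivable_in A (fun y => g (y, t)) x u.
Proof.
move=> It; rewrite /derivable_in admissible_space//.
by rewrite (funext (quotient_space _ _ _ _)).
Qed.

Lemma admissible_time x t : A x ->
  admissible (A `*` I) (x, t) (0, 1) = admissible I t 1.
Proof.
move=> Ax; rewrite (_ : [set h | _] = [set h | I (h *: 1 + t)])//.
by apply/seteqP; split=> h; rewrite /mkset line_time => // -[].
Qed.

Let quotient_time g x t h : h^-1 *: (g (h *: (0, 1) + (x, t)) - g (x, t)) =
  h^-1 *: (g (x, h *: 1 + t) - g (x, t)).
Proof. by rewrite line_time. Qed.

Lemma derive_in_time g x t : A x ->
  derive_in (A `*` I) g (x, t) (0, 1) = dt T (fun y r => g (y, r)) x t.
Proof.
by move=> Ax; rewrite /dt /derive_in admissible_time// (funext (quotient_time _ _ _)).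
Qed.

Lemma derivable_in_time g x t : A x ->
  derivable_in (A `*` I) g (x, t) (0, 1) =
  derivable_in I (fun r => g (x, r)) t 1.
Proof.
by move=> Ax; rewrite /derivable_in admissible_time// (funext (quotient_time _ _ _)).
Qed.

Lemma Ck_in_space g t k : I t ->
  Ck_in (A `*` I) setT k g -> Ck_in A setT k (fun y => g (y, t)).
Proof.
move=> It; have within_space g' : {within A `*` I, continuous g'} ->
    {within A, continuous (fun y => g' (y, t))}.
  move=> /subspace_continuousP cg; apply/subspace_continuousP => x Ax.
  apply: cvg_comp (cg (x, t) (conj Ax It)) => P.
  case=> -[B C] [/= nB nC] BCP.
  apply: filterS nB => y By Ay; apply: BCP => //; split => //=.
  exact: nbhs_singleton.
elim: k g => [|k IH] g [cg dg]; first by split => //; exact: within_space.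
split; [exact: within_space|move=> u _]; have [du cu] := dg (u, 0) Logic.I; split.
  by move=> x Ax; rewrite -derivable_in_space//; exact: du.
by apply: Ck_in_eq (IH _ cu) => x _; exact: derive_in_space.
Qed.

End Spacetime.

Lemma spacetime_proper {R : realType} (A : set 'cV[R]_3) T p u : open A ->
  (A `*` time_interval T) p ->
  ProperFilter (admissible (A `*` time_interval T) p u).
Proof.
by case: p u => [x t] [u s] oA [Ax It]; exact: spacetime_admissible_proper.
Qed.

Lemma smooth_spacetime_coord {R : realType} m n (A : set 'cV[R]_3) T
    (q : 'cV[R]_3 -> R -> 'M[R]_(m, n)) i j k :
  open A -> smooth_spacetime A T q ->
  Ck_in (A `*` time_interval T) setT k (fun p => q p.1 p.2 i j).
Proof.
by move=> oA qC; apply: Ck_in_coord (qC k) => p u Dp _; exact: spacetime_proper.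
Qed.

(** * Differentiability of functions with continuous partial derivatives *)

Section MeanValue.
Context {R : realType} {E : normedModType R}.
Implicit Types (g : E -> R) (x y e : E).

(** Turns a directional derivative into the derivative of a function of one real variable, to which
    the mean value theorem applies. *)
Lemma is_derive_line (W : normedModType R) (g : E -> W) y e (s : R) :
  derivable g (s *: e + y) e ->
  is_derive s 1 (fun r : R => g (r *: e + y)) ('D_e g (s *: e + y)).
Proof.
move=> dg.
have eq_quotient (h : R) : h^-1 *: (g ((h *: 1 + s) *: e + y) - g (s *: e + y)) =
    h^-1 *: (g (h *: e + (s *: e + y)) - g (s *: e + y)).
  by rewrite scalerDl addrA [h *: 1]mulr1.
by split; rewrite /derivable /derive (funext eq_quotient).
Qed.

Lemma MVT_line g y e (a : R) :
  (forall s : R, `|s| <= `|a| -> derivable g (s *: e + y) e) ->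
  exists2 s : R, `|s| <= `|a| & g (a *: e + y) - g y = a * 'D_e g (s *: e + y).
Proof.
move=> dg; pose G (s : R) := g (s *: e + y).
have dG (s : R) : `|s| <= `|a| -> is_derive s 1 G ('D_e g (s *: e + y)).
  by move=> sa; apply: is_derive_line; exact: dg.
have cG (b c : R) : (forall s, s \in `[b, c]%R -> `|s| <= `|a|) ->
    {within `[b, c], continuous G}.
  move=> bc; apply: derivable_within_continuous => s sbc.
  by have [] := dG s (bc s sbc).
have G0 : g y = G 0 by rewrite /G scale0r add0r.
(* The mean value theorem is applied on [[0, a]] or on [[a, 0]], according to the sign of [a]. *)
have [a0|/ltW a0] := leP 0 a.
  have bnd (s : R) : s \in `[0, a]%R -> `|s| <= `|a|.
    by rewrite in_itv /= => /andP[s0 sa]; rewrite !ger0_norm.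
  have [s sa Ga] := MVT_segment a0 (fun s sa => dG s (bnd s
    (subset_itv_oo_cc sa))) (cG _ _ bnd).
  exists s; first exact: bnd.
  by rewrite G0 -/(G a) Ga subr0 mulrC.
have bnd (s : R) : s \in `[a, 0]%R -> `|s| <= `|a|.
  by rewrite in_itv /= => /andP[sa s0]; rewrite !ler0_norm// lerN2.
have [s sa Ga] := MVT_segment a0 (fun s sa => dG s (bnd s
  (subset_itv_oo_cc sa))) (cG _ _ bnd).
exists s; first exact: bnd.
by rewrite G0 -/(G a) -opprB Ga sub0r mulrN opprK mulrC.
Qed.

End MeanValue.

Section ContinuousPartials.
Context {R : realType} {E : normedModType R} {J : finType}.
Variables (e : J -> E) (c : J -> E -> R).
Hypothesis c_linear : forall i a u v, c i (a *: u + v) = a * c i u + c i v.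
Hypothesis c_le : forall i h, `|c i h| <= `|h|.
Hypothesis sum_coord : forall h, \sum_i c i h *: e i = h.
Variables (g : E -> R) (x : E).
Hypothesis partials : forall i, \forall y \near x, derivable g y (e i).
Hypothesis cvg_partials : forall i, {for x, continuous ('D_(e i) g)}.

Let partial_sum_le (s : seq J) h :
  `|\sum_(i <- s) c i h *: e i| <= (\sum_(i <- s) `|e i|) * `|h|.
Proof.
rewrite big_distrl /=; apply: le_trans (ler_norm_sum _ _ _) _.
apply: ler_sum => i _; rewrite normrZ mulrC.
by apply: ler_wpM2l.
Qed.

(** Coordinates are changed one at a time along [s]. By the mean value theorem each change equals
    [c i h] times a partial derivative at a nearby point, so continuity of the partials costs at
    most [eps * |h|] per coordinate. *)
Let first_order (s : seq J) (eps : R) : 0 < eps ->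
  \forall h \near (0 : E),
    `|g (\sum_(i <- s) c i h *: e i + x) - g x
      - \sum_(i <- s) c i h * 'D_(e i) g x| <= (size s)%:R * eps * `|h|.
Proof.
move=> eps0; elim: s => [|i s IH].
  by near=> h; rewrite !big_nil add0r !subrr normr0 !mul0r.
have near_i : \forall y \near x,
    derivable g y (e i) /\ `|'D_(e i) g y - 'D_(e i) g x| <= eps.
  near=> y; split; first by near: y; exact: partials.
  by near: y; apply: cvgr_distC_le => //; exact: cvg_partials.
have [r /= r0 xr] := (nbhs_ballP _ _).1 near_i.
(* [K * |h|] bounds the distance from [x] to the segment used: the sum controls the previous
   coordinates, [|e i|] the current one, and [1] makes [K] positive. *)
pose K := \sum_(j <- s) `|e j| + `|e i| + 1.
have K0 : 0 < K by rewrite ltr_wpDl// addr_ge0// sumr_ge0.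
near=> h.
have hr : `|h| < r / K by near: h; apply: nbhs0_lt; rewrite divr_gt0.
have IHh : `|g (\sum_(j <- s) c j h *: e j + x) - g x
      - \sum_(j <- s) c j h * 'D_(e j) g x| <= (size s)%:R * eps * `|h|.
  by near: h.
set S := \sum_(j <- s) c j h *: e j.
have seg b : `|b| <= `|c i h| -> derivable g (b *: e i + (S + x)) (e i) /\
    `|'D_(e i) g (b *: e i + (S + x)) - 'D_(e i) g x| <= eps.
  move=> bc; apply: xr; rewrite -ball_normE /ball_ /=.
  rewrite addrA opprD addrCA subrr addr0 normrN.
  apply: le_lt_trans (ler_normD _ _) _; rewrite normrZ.
  have bh : `|b| <= `|h| by exact: le_trans bc (c_le _ _).
  have : K * `|h| < r by rewrite mulrC -ltr_pdivlMr.
  apply: le_lt_trans; rewrite /K 2!mulrDl mul1r.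
  rewrite [leLHS]addrC -[leLHS]addr0 lerD// lerD ?partial_sum_le//.
  by rewrite mulrC ler_wpM2l.
have [b bc Eb] := MVT_line (fun b bc => (seg b bc).1).
rewrite !big_cons -/S -(addrA (c i h *: e i)).
have -> : g (c i h *: e i + (S + x)) - g x -
    (c i h * 'D_(e i) g x + \sum_(j <- s) c j h * 'D_(e j) g x) =
    c i h * ('D_(e i) g (b *: e i + (S + x)) - 'D_(e i) g x) +
    (g (S + x) - g x - \sum_(j <- s) c j h * 'D_(e j) g x).
  by rewrite mulrBr -Eb; ring.
apply: le_trans (ler_normD _ _) _.
rewrite /= -natr1 mulrDl mul1r mulrDl [leRHS]addrC lerD//.
by rewrite normrM mulrC ler_pM//; exact: (seg b bc).2.
Unshelve. all: by end_near. Qed.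

Let D h := \sum_i c i h * 'D_(e i) g x.

Let D_linear : linear D.
Proof.
move=> a u v; rewrite /D scaler_sumr -big_split /=; apply: eq_bigr => i _.
by rewrite c_linear mulrDl -mulrA.
Qed.

(** Taken over all coordinates, [first_order] says that [D] is the differential. The basis [e] and
    coordinates [c] are abstract so as to serve both space and spacetime. *)
Lemma continuous_partials_differentiable : differentiable g x.
Proof.
pose DM := GRing.isLinear.Build _ _ _ _ _ D_linear.
pose DL : {linear E -> R^o} := HB.pack D DM.
have DLc : continuous DL.
  apply/linear_bounded_continuous; exists (\sum_i `|'D_(e i) g x|); split.
    exact: num_real.
  move=> M /ltW MD; near=> h; apply: le_trans MD.
  rewrite -[X in `|X|]/(D h); apply: le_trans (ler_norm_sum _ _ _) _.
  apply: ler_sum => i _; rewrite normrM ler_piMl//.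
  apply: le_trans (c_le i h) _; apply/ltW.
  by near: h; exact: nbhs0_lt.
have Dg : g \o shift x = cst (g x) + DL +o_ 0 id.
  apply/eqaddoP => eps eps0.
  (* One more than the number of coordinates, so that [eps] can be divided by it even when [J] is
     empty. *)
  have N0 : 0 < (size (index_enum J)).+1%:R :> R by [].
  have := first_order (index_enum J) (divr_gt0 eps0 N0).
  apply: filterS => h; rewrite sum_coord => hle.
  rewrite -[X in `|X|]/(g (h + x) - (g x + D h)) opprD addrA.
  apply: le_trans hle _; apply: ler_wpM2r => //.
  by rewrite mulrA ler_pdivrMr// mulrC ler_wpM2l ?(ltW eps0)// ler_nat.
have dgE := diff_unique DLc Dg.
by apply/diff_locallyP; rewrite dgE.
Unshelve. all: by end_near. Qed.

End ContinuousPartials.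

Lemma normr_le_mx_coord {R : realType} m n (M : 'M[R]_(m, n)) i j :
  `|M i j| <= `|M|.
Proof.
by rewrite [leRHS]/Num.Def.normr/= mx_normrE; exact: (le_bigmax _ _ (i, j)).
Qed.

Lemma sum_e3 {R : realType} (h : 'cV[R]_3) : \sum_i h i 0 *: e3 i = h.
Proof.
rewrite [RHS]matrix_sum_delta; apply: eq_bigr => i _.
by rewrite big_ord1.
Qed.

(** [option 'I_3] indexes the coordinates of spacetime: [None] is time, [Some i] a space
    direction. *)
Lemma big_option {R : realType} {W : normedModType R} (F : option 'I_3 -> W) :
  \sum_o F o = F None + \sum_i F (Some i).
Proof.
rewrite (bigD1 None)//=; congr (_ + _); rewrite (reindex_omap Some id).
  by apply: eq_bigl => j; rewrite eqxx.
by case.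
Qed.

Section SmoothDifferentiable.
Context {R : realType}.
Notation V3 := 'cV[R]_3.

Lemma Ck1_partials {E : normedModType R} (D : set E) (g : E -> R) x u :
  nbhs x D -> Ck_in D setT 1 g ->
  (\forall y \near x, derivable g y u) /\ {for x, continuous ('D_u g)}.
Proof.
move=> xD [_ /(_ u Logic.I)[dg [cg _]]].
have Dx : D x := nbhs_singleton xD.
have near_D : \forall y \near x, nbhs y D := nbhs_interior xD.
split.
  near=> y; have Dy : nbhs y D by near: y.
  by rewrite -(derivable_in_interior _ _ Dy); exact: dg (nbhs_singleton Dy).
move/subspace_continuousP : cg => /(_ x Dx).
rewrite within_interior// /from_subspace (derive_in_interior _ _ xD).
apply: cvg_trans; apply: near_eq_cvg; near=> y.
by apply: derive_in_interior; near: y.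
Unshelve. all: by end_near. Qed.

Lemma Ck1_differentiable (D : set V3) (g : V3 -> R) x :
  nbhs x D -> Ck_in D setT 1 g -> differentiable g x.
Proof.
move=> xD gC1; pose c (i : 'I_3) (h : V3) := h i 0.
apply: (@continuous_partials_differentiable _ _ _ e3 c).
- by move=> i a u v; rewrite /c !mxE.
- by move=> i h; exact: normr_le_mx_coord.
- exact: sum_e3.
- by move=> i; exact: (Ck1_partials _ xD gC1).1.
- by move=> i; exact: (Ck1_partials _ xD gC1).2.
Qed.

Lemma Ck1_differentiable_spacetime (D : set (V3 * R)) (g : V3 * R -> R) p :
  nbhs p D -> Ck_in D setT 1 g -> differentiable g p.
Proof.
move=> pD gC1.
pose c (o : option 'I_3) (h : V3 * R) := if o is Some i then h.1 i 0 else h.2.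
pose e (o : option 'I_3) : V3 * R :=
  if o is Some i then (e3 i, 0) else (0, 1).
apply: (@continuous_partials_differentiable _ _ _ e c).
- by case=> [i|] a u v; rewrite /c /= ?mxE.
- case=> [i|] h; rewrite /c prod_normE le_max ?lexx ?orbT//.
  by rewrite normr_le_mx_coord.
- move=> h; rewrite big_option /c /e /=.
  apply: injective_projections => /=.
    rewrite scaler0 add0r -[RHS]sum_e3.
    by rewrite (big_morph fst (id1 := 0) (op1 := +%R)).
  rewrite (big_morph snd (id1 := 0) (op1 := +%R))//=.
  rewrite big1 ?addr0 => [|i _]; first exact: mulr1.
  exact: mulr0.
- by move=> i; exact: (Ck1_partials _ pD gC1).1.
- by move=> i; exact: (Ck1_partials _ pD gC1).2.
Qed.

End SmoothDifferentiable.

(** * The chain rule *)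

Section Chain.
Context {R : realType} {V E W : normedModType R}.

(** Only derivability of [p] along [u] is given. Its restriction [l] to a line is a derivable
    function of one real variable, hence differentiable, and the chain rule for differentials
    applies to [g \o l]. *)
Lemma is_derive_comp_diff (p : V -> E) (g : E -> W) x u dp :
  is_derive x u p dp -> differentiable g (p x) ->
  is_derive x u (g \o p) ('D_dp g (p x)).
Proof.
move=> [dpx <-] dg.
pose l (h : R) := p (h *: u + x).
have l0 : l 0 = p x by rewrite /l scale0r add0r.
have dl : differentiable l 0.
  by apply/derivable1_diffP; exact: ((derivable1P p x u).1 dpx).
have dgl : differentiable g (l 0) by rewrite l0.
have dgp : derivable (g \o p) x u.
  apply/derivable1P/derivable1_diffP; rewrite -[X in differentiable X _]/(g \o l).
  exact: differentiable_comp.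
split=> //.
have line0 (F : normedModType R) (f : V -> F) : derivable f x u ->
    'D_u f x = 'D_1 (fun h : R => f (h *: u + x)) 0.
  move=> df; have dfx : derivable f ((0 : R) *: u + x) u.
    by rewrite scale0r add0r.
  by have [_ ->] := is_derive_line dfx; rewrite scale0r add0r.
rewrite (line0 _ (g \o p))// (line0 _ p)// -/l.
rewrite -[LHS]/('D_1 (g \o l) 0) deriveE; last exact: differentiable_comp.
by rewrite diff_comp//= l0 -!deriveE.
Qed.

End Chain.

(** * Smooth functions on open sets *)

Lemma continuous_comp_within (S T U : topologicalType) (A : set S) (B : set T)
    (p : S -> T) (g : T -> U) :
  (forall x, A x -> B (p x)) -> {within A, continuous p} ->
  {within B, continuous g} -> {within A, continuous (fun x => g (p x))}.
Proof.
move=> AB /subspace_continuousP cp /subspace_continuousP cg.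
apply/subspace_continuousP => x Ax; apply: cvg_comp (cg _ (AB _ Ax)).
move=> P nP.
have pP : \forall y \near x, A y -> B (p y) -> P (p y) := cp x Ax _ nP.
suff : \forall y \near x, A y -> P (p y) by [].
by apply: filterS pP => y + Ay; apply=> //; exact: AB.
Qed.

Section SmoothLinear.
Context {R : realType} {V : normedModType R} (D : set V).
Hypothesis DP : forall x u, D x -> ProperFilter (admissible D x u).
Implicit Types (f g : V -> R) (k : nat) (a : R).

(** Keeping [D] general covers spacetime up to [t = 0]. The form [f + a g] gives sums with [a = 1]
    and differences with [a = -1]. *)
Lemma derive_in_linear f g a x u : D x ->
  derivable_in D f x u -> derivable_in D g x u ->
  derivable_in D (fun y => f y + a * g y) x u /\
  derive_in D (fun y => f y + a * g y) x u =
  derive_in D f x u + a * derive_in D g x u.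
Proof.
move=> Dx /cvg_ex[/= l fl] /cvg_ex[/= m gm]; have FF := DP u Dx.
have fgl : h^-1 *: ((f (h *: u + x) + a * g (h *: u + x)) - (f x + a * g x))
    @[h --> admissible D x u] --> l + a * m.
  have E (h : R) :
      h^-1 *: ((f (h *: u + x) + a * g (h *: u + x)) - (f x + a * g x)) =
      h^-1 *: (f (h *: u + x) - f x) + a * (h^-1 *: (g (h *: u + x) - g x)).
    by rewrite /GRing.scale /=; ring.
  by rewrite (funext E); apply: cvgD fl _; apply: cvgM gm; exact: cvg_cst.
split; first by apply/cvg_ex; exists (l + a * m).
by rewrite /derive_in (cvg_lim _ fgl)// (cvg_lim _ fl)// (cvg_lim _ gm).
Qed.

Lemma Ck_in_linear k f g a : Ck_in D setT k f -> Ck_in D setT k g ->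
  Ck_in D setT k (fun x => f x + a * g x).
Proof.
have cl f' g' : {within D, continuous f'} -> {within D, continuous g'} ->
    {within D, continuous (fun x => f' x + a * g' x)}.
  move=> /subspace_continuousP cf /subspace_continuousP cg.
  apply/subspace_continuousP => x Dx; apply: cvgD; first exact: cf.
  by apply: cvgM; [exact: cvg_cst|exact: cg].
elim: k f g => [|k IH] f g [cf kf] [cg kg]; first by split=> //; exact: cl.
split; [exact: cl|move=> u _].
have [df kdf] := kf u Logic.I; have [dg kdg] := kg u Logic.I; split=> [x Dx|].
  by have [] := derive_in_linear a Dx (df x Dx) (dg x Dx).
apply: Ck_in_eq (IH _ _ kdf kdg) => x; rewrite inE => Dx.
by have [_ ->] := derive_in_linear a Dx (df x Dx) (dg x Dx).
Qed.

Lemma derive_in_cst (b : R) x u : D x ->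
  derivable_in D (fun=> b) x u /\ derive_in D (fun=> b) x u = 0.
Proof.
move=> Dx; have FF := DP u Dx.
have cb : h^-1 *: (b - b) @[h --> admissible D x u] --> (0 : R).
  by rewrite subrr; under eq_fun do rewrite scaler0; exact: cvg_cst.
by split; [apply/cvg_ex; exists 0|exact: cvg_lim cb].
Qed.

Lemma Ck_in_cst k (b : R) : Ck_in D setT k (fun=> b).
Proof.
have cc (c : R) : {within D, continuous (fun=> c)}.
  by apply: continuous_subspaceT => x; exact: cvg_cst.
elim: k b => [|k IH] b; split => // u _; split=> [x Dx|].
  by have [] := derive_in_cst b u Dx.
apply: Ck_in_eq (IH 0) => x; rewrite inE => Dx.
by have [_ ->] := derive_in_cst b u Dx.
Qed.

Lemma Ck_in_sum k n (F : 'I_n -> V -> R) : (forall i, Ck_in D setT k (F i)) ->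
  Ck_in D setT k (fun x => \sum_i F i x).
Proof.
elim: n F => [|n IH] F kF.
  by apply: Ck_in_eq (Ck_in_cst k 0) => x _; rewrite big_ord0.
apply: Ck_in_eq (Ck_in_linear 1 (kF ord0) (IH (fun i => F (lift ord0 i))
  (fun i => kF _))) => x _.
by rewrite big_ord_recl mul1r.
Qed.

Lemma derive_in_sum n (F : 'I_n -> V -> R) x u : D x ->
  (forall i, derivable_in D (F i) x u) ->
  derivable_in D (fun y => \sum_i F i y) x u /\
  derive_in D (fun y => \sum_i F i y) x u = \sum_i derive_in D (F i) x u.
Proof.
move=> Dx; elim: n F => [|n IH] F dF.
  rewrite big_ord0; under eq_fun do rewrite big_ord0; exact: derive_in_cst.
have [dS ES] := IH (fun i => F (lift ord0 i)) (fun i => dF _).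
have [dFS EFS] := derive_in_linear 1 Dx (dF ord0) dS.
have E y : F ord0 y + 1 * \sum_i F (lift ord0 i) y = \sum_i F i y.
  by rewrite big_ord_recl mul1r.
by rewrite -(funext E); split=> //; rewrite EFS ES mul1r big_ord_recl.
Qed.

End SmoothLinear.

Section SmoothAlgebra.
Context {R : realType} {V : normedModType R} (A : set V).
Hypothesis oA : open A.
Implicit Types (f g : V -> R) (k : nat).

Let nA x : A x -> nbhs x A.
Proof. by move=> Ax; exact: (open_nbhs_nbhs (conj oA Ax)). Qed.

Lemma Ck_in_derivable k f x u : Ck_in A setT k.+1 f -> A x -> derivable f x u.
Proof.
move=> [_ /(_ u Logic.I)[df _]] Ax.
by rewrite -(derivable_in_interior _ _ (nA Ax)); exact: df.
Qed.

Lemma Ck_in_derive k f u : Ck_in A setT k.+1 f -> Ck_in A setT k ('D_u f).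
Proof.
move=> [_ /(_ u Logic.I)[_]]; apply: Ck_in_eq => x; rewrite inE => Ax.
exact: derive_in_interior (nA Ax).
Qed.

Lemma Ck_in_openS k f : {within A, continuous f} ->
  (forall u, (forall x, A x -> derivable f x u) /\ Ck_in A setT k ('D_u f)) ->
  Ck_in A setT k.+1 f.
Proof.
move=> cf df; split=> // u _; have [dfu ku] := df u; split=> [x Ax|].
  by rewrite (derivable_in_interior _ _ (nA Ax)); exact: dfu.
apply: Ck_in_eq ku => x; rewrite inE => Ax.
by rewrite (derive_in_interior _ _ (nA Ax)).
Qed.

(** By the Leibniz rule the derivative is a sum of products of functions of class one lower, so the
    induction hypothesis and linearity conclude. *)
Lemma Ck_inM k f g : Ck_in A setT k f -> Ck_in A setT k g ->
  Ck_in A setT k (fun x => f x * g x).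
Proof.
have cM f' g' : {within A, continuous f'} -> {within A, continuous g'} ->
    {within A, continuous (fun x => f' x * g' x)}.
  move=> /subspace_continuousP cf /subspace_continuousP cg.
  by apply/subspace_continuousP => x Ax; apply: cvgM; [exact: cf|exact: cg].
elim: k f g => [|k IH] f g kf kg.
  by case: kf kg => cf _ [cg _]; split=> //; exact: cM.
apply: Ck_in_openS; first by apply: cM; [case: kf|case: kg].
move=> u; have df x : A x -> derivable f x u by exact: Ck_in_derivable kf.
have dg x : A x -> derivable g x u by exact: Ck_in_derivable kg.
split=> [x Ax|]; first by apply: derivableM; [exact: df|exact: dg].
have Mf := IH _ _ (Ck_inW kf) (Ck_in_derive u kg).
have Mg := IH _ _ (Ck_inW kg) (Ck_in_derive u kf).
have AP x u' (Ax : A x) := open_admissible_proper u' oA Ax.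
apply: Ck_in_eq (Ck_in_linear AP 1 Mf Mg) => x; rewrite inE => Ax.
by rewrite mul1r deriveM//; [exact: df|exact: dg].
Qed.

End SmoothAlgebra.

Lemma Ck_in_le {R : realType} {V W : normedModType R} (D L : set V) k l
    (f : V -> W) : (l <= k)%N -> Ck_in D L k f -> Ck_in D L l f.
Proof.
move=> /subnK <-; elim: (k - l)%N => [|n IH]//.
by rewrite addSn => /Ck_inW; exact: IH.
Qed.

Lemma derive_sum_e3 {R : realType} {W : normedModType R} (g : 'cV[R]_3 -> W) x w :
  differentiable g x -> 'D_w g x = \sum_i w i 0 *: 'D_(e3 i) g x.
Proof.
move=> dg; rewrite deriveE// -[in LHS](sum_e3 w) linear_sum.
by apply: eq_bigr => i _; rewrite linearZ deriveE.
Qed.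

Section SmoothComp.
Context {R : realType} {V : normedModType R}.
Variables (B : set V) (A : set 'cV[R]_3) (p : V -> 'cV[R]_3).
Hypotheses (oB : open B) (oA : open A).
Hypothesis BA : forall x, B x -> A (p x).

Lemma derive_comp_coord (g : 'cV[R]_3 -> R) y u :
  derivable p y u -> differentiable g (p y) ->
  'D_u (g \o p) y = \sum_i 'D_u p y i 0 * 'D_(e3 i) g (p y).
Proof.
move=> dp dg; have [_ ->] := is_derive_comp_diff (derivableP dp) dg.
exact: derive_sum_e3.
Qed.

(** The chain rule writes the derivative as a sum of products of components of ['D_u p] with
    partials of [g] composed with [p]; the induction hypothesis handles the latter. *)
Lemma Ck_in_comp k (g : 'cV[R]_3 -> R) : Ck_in B setT k p -> Ck_in A setT k g ->
  Ck_in B setT k (fun y => g (p y)).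
Proof.
elim: k g => [|k IH] g kp kg.
  case: kp kg => cp _ [cg _]; split=> //; exact: continuous_comp_within cg.
have cp := proj1 kp; have cg := proj1 kg.
have nB x (Bx : B x) : nbhs x B := open_nbhs_nbhs (conj oB Bx).
have dg x : A x -> differentiable g x.
  move=> Ax; apply: Ck1_differentiable (open_nbhs_nbhs (conj oA Ax)) _.
  exact: Ck_in_le kg.
have dp x u : B x -> derivable p x u.
  move=> Bx; rewrite -(derivable_in_interior _ _ (nB x Bx)).
  by apply: (proj1 (proj2 kp u Logic.I)).
apply: Ck_in_openS => //; first exact: continuous_comp_within cg.
move=> u; split=> [y By|].
  have [+ _] := is_derive_comp_diff (derivableP (dp y u By)) (dg _ (BA By)).
  by [].
have BP x u' (Bx : B x) := open_admissible_proper u' oB Bx.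
have kpu i : Ck_in B setT k (fun y => 'D_u p y i 0).
  have := proj2 (proj2 kp u Logic.I).
  move=> /(Ck_in_coord i 0 (fun x u Bx _ => BP x u Bx)).
  apply: Ck_in_eq => y; rewrite inE => By.
  by rewrite (derive_in_interior _ _ (nB y By)).
have kgi i : Ck_in B setT k (fun y => 'D_(e3 i) g (p y)).
  exact: (IH _ (Ck_inW kp) (Ck_in_derive oA (e3 i) kg)).
apply: Ck_in_eq (Ck_in_sum BP (fun i => Ck_inM oB (kpu i) (kgi i))) => y.
rewrite inE => By; apply/esym.
by apply: derive_comp_coord; [exact: dp|exact: dg (BA By)].
Qed.

End SmoothComp.

(** * Equality of mixed derivatives *)

(** The mean value theorem is applied to [F s = G s h - G s 0], then to [Gs s]. Each derivative is
    required only for interior values of its own variable, continuity up to the endpoints. *)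
Lemma second_difference {R : realType} (G Gs Gst : R -> R -> R) (h : R) :
  0 < h ->
  (forall t, t \in `[0, h]%R -> {within `[0, h], continuous (G ^~ t)}) ->
  (forall s t, s \in `]0, h[%R -> t \in `[0, h]%R ->
     is_derive s 1 (G ^~ t) (Gs s t)) ->
  (forall s, s \in `]0, h[%R -> {within `[0, h], continuous (Gs s)}) ->
  (forall s t, s \in `]0, h[%R -> t \in `]0, h[%R ->
     is_derive t 1 (Gs s) (Gst s t)) ->
  exists s t, [/\ s \in `]0, h[%R, t \in `]0, h[%R &
    G h h - G h 0 - (G 0 h - G 0 0) = Gst s t * h * h].
Proof.
move=> h0 cG dG cGs dGs.
have h00 : 0 \in `[0, h]%R by rewrite in_itv /= lexx ltW.
have hh : h \in `[0, h]%R by rewrite in_itv /= lexx ltW.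
pose F s := G s h - G s 0.
have dF s : s \in `]0, h[%R -> is_derive s 1 F (Gs s h - Gs s 0).
  by move=> sh; exact: (is_deriveB (dG s h sh hh) (dG s 0 sh h00)).
have cF : {within `[0, h], continuous F}.
  have /subspace_continuousP ch := cG h hh.
  have /subspace_continuousP c0 := cG 0 h00.
  apply/subspace_continuousP => s sh.
  by apply: cvgB; [exact: (ch s sh)|exact: (c0 s sh)].
have [s sh Es] := MVT h0 dF cF.
have [t th Et] := MVT h0 (dGs s ^~ sh) (cGs s sh).
exists s, t; split=> //.
by rewrite -[LHS]/(F h - F 0) Es Et subr0.
Qed.

Lemma within_continuous_line {R : realType} {V : normedModType R}
    (W : topologicalType) (D : set V) (I : set R) (f : V -> W) y u :
  {within D, continuous f} -> (forall s, I s -> D (s *: u + y)) ->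
  {within I, continuous (fun s => f (s *: u + y))}.
Proof.
move=> cf ID.
apply: (@continuous_comp_within R V W I D (fun s => s *: u + y) f ID _ cf).
apply: continuous_subspaceT => s.
by apply: cvgD; [exact: scalel_continuous|exact: cvg_cst].
Qed.

Section Schwarz.
Context {R : realType} {V : normedModType R}.
Implicit Types (D : set V) (g : V -> R) (x u w : V).

(* [admissible D y u = 0^'] says that the derivative at [y] along [u] is
   two-sided; it is only needed off the edges of the parallelogram, so that
   [x] may lie on the boundary of [D]. *)
Definition two_sided_square D x u w (h : R) :=
  [/\ forall s t, s \in `[0, h]%R -> t \in `[0, h]%R ->
        D (s *: u + (t *: w + x)),
      forall s t, s \in `]0, h[%R -> t \in `[0, h]%R ->
        admissible D (s *: u + (t *: w + x)) u = 0^' &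
      forall s t, s \in `[0, h]%R -> t \in `]0, h[%R ->
        admissible D (s *: u + (t *: w + x)) w = 0^'].

Lemma two_sided_squareC D x u w h :
  two_sided_square D x u w h -> two_sided_square D x w u h.
Proof.
by case=> sq su sw; split=> s t sh th; rewrite addrCA; [exact: sq|exact: sw|exact: su].
Qed.

Lemma two_sided_squareW D x u w (h h' : R) : h' <= h ->
  two_sided_square D x u w h -> two_sided_square D x u w h'.
Proof.
move=> hh [sq su sw].
have cc s : s \in `[0, h']%R -> s \in `[0, h]%R.
  by rewrite !in_itv /= => /andP[-> /le_trans]; exact.
have oo s : s \in `]0, h'[%R -> s \in `]0, h[%R.
  by rewrite !in_itv /= => /andP[-> /lt_le_trans]; exact.
by split=> s t sh th; [apply: sq|apply: su|apply: sw]; by [exact: cc|exact: oo].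
Qed.

Lemma two_sided_derive D (f : V -> R) y e : admissible D y e = (0 : R)^' ->
  derivable_in D f y e -> derivable f y e /\ derive_in D f y e = 'D_e f y.
Proof. by rewrite /derivable_in /derive_in => ->. Qed.

Lemma mixed_second_difference D g x u w (h : R) : 0 < h ->
  two_sided_square D x u w h -> Ck_in D setT 2 g ->
  exists s t, [/\ s \in `]0, h[%R, t \in `]0, h[%R &
    g (h *: u + (h *: w + x)) - g (h *: u + x) - (g (h *: w + x) - g x) =
    derive_in D (fun y => derive_in D g y u) (s *: u + (t *: w + x)) w * h * h].
Proof.
move=> h0 [sq su sw] [cg dg].
have [dgu [cgu dgu']] := dg u Logic.I; have [dguw _] := dgu' w Logic.I.
have h00 : 0 \in `[0, h]%R by rewrite in_itv /= lexx ltW.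
have [||||s [t [sh th E]]] := @second_difference R
  (fun s t => g (s *: u + (t *: w + x)))
  (fun s t => derive_in D g (s *: u + (t *: w + x)) u)
  (fun s t => derive_in D (fun y => derive_in D g y u) (s *: u + (t *: w + x)) w)
  h h0.
- move=> t th; apply: within_continuous_line cg _ => s sh; exact: sq.
- move=> s t sh th; have Dp := sq s t (subset_itv_oo_cc sh) th.
  have [dp ->] := two_sided_derive (su s t sh th) (dgu _ Dp).
  exact: is_derive_line.
- move=> s sh; have E t : s *: u + (t *: w + x) = t *: w + (s *: u + x).
    by rewrite addrCA.
  rewrite (funext (fun t => congr1 (fun y => derive_in D g y u) (E t))).
  apply: within_continuous_line cgu _ => t th.
  by rewrite -E; exact: sq (subset_itv_oo_cc sh) th.
- move=> s t sh th; have E r : s *: u + (r *: w + x) = r *: w + (s *: u + x).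
    by rewrite addrCA.
  have sh' := subset_itv_oo_cc sh.
  have Dp := sq s t sh' (subset_itv_oo_cc th).
  have [dp ->] := two_sided_derive (sw s t sh' th) (dguw _ Dp).
  rewrite (funext (fun r => congr1 (fun y => derive_in D g y u) (E r))).
  by rewrite E in dp *; exact: is_derive_line.
- by exists s, t; split=> //; rewrite -E !scale0r !add0r.
Qed.

(** The second difference over a small parallelogram is symmetric in [u] and [w], and is [h * h]
    times either mixed derivative at some point of it. By continuity at [x], distinct values [a] and
    [b] would both lie within half their distance of one common number. *)
Lemma derive_inC D g x u w (d : R) : 0 < d -> two_sided_square D x u w d ->
  Ck_in D setT 2 g ->
  derive_in D (fun y => derive_in D g y u) x w =
  derive_in D (fun y => derive_in D g y w) x u.
Proof.
move=> d0 sqd gC2; apply/eqP; apply: contraT => ab.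
set a := derive_in _ _ x w in ab *; set b := derive_in _ _ x u in ab *.
have Dx : D x.
  case: sqd => /(_ 0 0) + _ _; rewrite !scale0r !add0r; apply;
  by rewrite in_itv /= lexx ltW.
have e0 : 0 < `|a - b| / 2 by rewrite divr_gt0// normr_gt0 subr_eq0.
have near_mixed u' w' : \forall y \near x, D y ->
    `|derive_in D (fun y => derive_in D g y u') x w' -
      derive_in D (fun y => derive_in D g y u') y w'| < `|a - b| / 2.
  have [_ /(_ u' Logic.I)[_ [_ /(_ w' Logic.I)[_ [+ _]]]]] := gC2.
  move=> /subspace_continuousP/(_ x Dx)/cvgrPdist_lt/(_ _ e0).
  by [].
have [r /= r0 xr] := (nbhs_ballP _ _).1 (filterI (near_mixed u w) (near_mixed w u)).
(* The added [1] makes [K] positive and the resulting bound [h * (|u| + |w|) < r] strict. *)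
pose K := `|u| + `|w| + 1.
have K0 : 0 < K by rewrite ltr_wpDl// addr_ge0.
have [h h0 [hd hr]] : exists2 h, 0 < h & h <= d /\ h * (`|u| + `|w|) < r.
  exists (Num.min d (r / K)); first by rewrite lt_min d0 divr_gt0.
  split; first by rewrite ge_min lexx.
  apply: (@lt_le_trans _ _ (Num.min d (r / K) * K)).
    by rewrite ltr_pM2l ?ltrDl// lt_min d0 divr_gt0.
  by rewrite -ler_pdivlMr// ge_min lexx orbT.
have sqh := two_sided_squareW hd sqd.
have in_ball u' w' (s t : R) : `|u'| + `|w'| = `|u| + `|w| ->
    s \in `]0, h[%R -> t \in `]0, h[%R -> ball x r (s *: u' + (t *: w' + x)).
  rewrite !in_itv /= => uw /andP[s0 sh] /andP[t0 th].
  rewrite -ball_normE /ball_ /= addrA opprD addrCA subrr addr0 normrN.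
  apply: le_lt_trans (ler_normD _ _) _; rewrite !normrZ !gtr0_norm//.
  apply: le_lt_trans hr; rewrite -uw mulrDr.
  by rewrite lerD// ler_wpM2r// ltW.
have [s1 [t1 [s1h t1h E1]]] := mixed_second_difference h0 sqh gC2.
have [t2 [s2 [t2h s2h E2]]] := mixed_second_difference h0 (two_sided_squareC sqh) gC2.
have [sq _ _] := sqh; have [sq' _ _] := two_sided_squareC sqh.
have [/(_ (sq _ _ (subset_itv_oo_cc s1h) (subset_itv_oo_cc t1h))) A1 _] :=
  xr _ (in_ball u w _ _ erefl s1h t1h).
have [_ /(_ (sq' _ _ (subset_itv_oo_cc t2h) (subset_itv_oo_cc s2h))) A2] :=
  xr _ (in_ball w u _ _ (addrC _ _) t2h s2h).
(* Multiplied by [h * h], both sides equal the same second difference. *)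
have E12 : derive_in D (fun y => derive_in D g y u) (s1 *: u + (t1 *: w + x)) w =
    derive_in D (fun y => derive_in D g y w) (t2 *: w + (s2 *: u + x)) u.
  apply: (mulIf (lt0r_neq0 h0)); apply: (mulIf (lt0r_neq0 h0)).
  have pC : h *: w + (h *: u + x) = h *: u + (h *: w + x) by rewrite addrCA.
  apply: etrans (esym E1) _; apply: etrans _ E2; rewrite pC.
  have swap (a' b' c' d' : R) : a' - b' - (c' - d') = a' - c' - (b' - d') by ring.
  exact: swap.
have far_apart (a' b' c' : R) : `|a' - c'| < `|a' - b'| / 2 ->
    `|b' - c'| < `|a' - b'| / 2 -> false.
  rewrite [`|b' - c'|]distrC => ac cb.
  by have := le_lt_trans (ler_distD c' a' b') (ltrD ac cb); rewrite -splitr ltxx.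
by apply: (far_apart a b _ _ A2); rewrite -E12; exact: A1.
Qed.

End Schwarz.

Section MixedPartials.
Context {R : realType}.
Notation V3 := 'cV[R]_3.

Lemma near_interval {P : set R} : (\forall s \near 0, P s) ->
  exists2 d : R, 0 < d & forall s, s \in `[0, d]%R -> P s.
Proof.
move=> /nbhs_ballP[e /= e0 Pe]; exists (e / 2); first by rewrite divr_gt0.
move=> s; rewrite in_itv /= => /andP[s0 se]; apply: Pe.
rewrite /ball /= sub0r normrN ger0_norm//; apply: le_lt_trans se _.
by rewrite ltr_pdivrMr// ltr_pMr// ltr1n.
Qed.

Lemma open_two_sided_square {V : normedModType R} (A : set V) x u w :
  open A -> A x -> exists2 d : R, 0 < d & two_sided_square A x u w d.
Proof.
move=> oA Ax.
have nA y : A y -> nbhs y A by move=> Ay; exact: (open_nbhs_nbhs (conj oA Ay)).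
have [r /= r0 xr] := (nbhs_ballP _ _).1 (nA x Ax).
pose K := `|u| + `|w| + 1.
have K0 : 0 < K by rewrite ltr_wpDl// addr_ge0.
have d0 : 0 < r / K by rewrite divr_gt0.
exists (r / K) => //.
have sq s t : s \in `[0, r / K]%R -> t \in `[0, r / K]%R ->
    A (s *: u + (t *: w + x)).
  rewrite !in_itv /= => /andP[s0 sd] /andP[t0 td]; apply: xr.
  rewrite -ball_normE /ball_ /= addrA opprD addrCA subrr addr0 normrN.
  apply: le_lt_trans (ler_normD _ _) _; rewrite !normrZ !ger0_norm//.
  apply: (@le_lt_trans _ _ (r / K * (`|u| + `|w|))).
    by rewrite mulrDr lerD// ler_wpM2r.
  by rewrite -[ltRHS](divfK (lt0r_neq0 K0)) ltr_pM2l// ltrDl.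
by split=> // s t sd td; apply: admissible_interior; apply: nA; apply: sq => //;
  exact: subset_itv_oo_cc.
Qed.

Lemma deriveC {V : normedModType R} (A : set V) (g : V -> R) x u w :
  open A -> A x -> Ck_in A setT 2 g -> 'D_w ('D_u g) x = 'D_u ('D_w g) x.
Proof.
move=> oA Ax gC2; have [d d0 sq] := open_two_sided_square u w oA Ax.
have nA y : A y -> nbhs y A by move=> Ay; exact: (open_nbhs_nbhs (conj oA Ay)).
have E e e' : derive_in A (fun y => derive_in A g y e) x e' = 'D_e' ('D_e g) x.
  rewrite (derive_in_interior _ _ (nA x Ax)); apply: near_eq_derive.
  by apply: filterS (nA x Ax) => y Ay; rewrite (derive_in_interior _ _ (nA y Ay)).
by rewrite -!E; exact: derive_inC d0 sq gC2.
Qed.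

Variables (A : set V3) (T : \bar R).
Hypothesis oA : open A.
Notation I := (time_interval T).
Notation D := (A `*` I).

Lemma time_interval_interior t : I t -> 0 < t -> nbhs t I.
Proof.
move=> [_ tT] t0; near=> r; split; last by near: r; exact: nbhs_lt_ereal.
by apply/ltW; near: r; exact: lt_nbhsr.
Unshelve. all: by end_near. Qed.

Lemma spacetime_interior y t : A y -> I t -> 0 < t -> nbhs (y, t) D.
Proof.
move=> Ay It t0; exists (A, I) => //=; split.
  exact: (open_nbhs_nbhs (conj oA Ay)).
exact: time_interval_interior.
Qed.

Lemma dt_eq {W : normedModType R} (q q' : V3 -> R -> W) x t :
  (forall r, I r -> q x r = q' x r) -> I t -> dt T q x t = dt T q' x t.
Proof. by move=> qq' It; apply: derive_in_eq => // r; rewrite inE; exact: qq'. Qed.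

(** The square runs forward in time, so it stays in [D] even when [t = 0]. On its initial edge only
    spatial derivatives must be two-sided, which holds because [A] is open; time derivatives are
    taken at strictly later, hence interior, times. *)
Lemma spacetime_two_sided_square x t u : A x -> I t ->
  exists2 d : R, 0 < d & two_sided_square D (x, t) (u, 0) (0, 1) d.
Proof.
move=> Ax It.
have [d1 d10 sA] := near_interval (near_line u (open_nbhs_nbhs (conj oA Ax))).
have [d2 d20 sT] := near_interval (near_line (1 : R) (nbhs_lt_ereal It.2)).
have pE (r s : R) : r *: ((u, 0) : V3 * R) + (s *: ((0, 1) : V3 * R) + (x, t)) =
    (r *: u + x, s *: 1 + t).
  rewrite line_time; congr pair; rewrite /= scaler0 add0r//.
have le_itv (d s : R) : Num.min d1 d2 <= d -> s \in `[0, Num.min d1 d2]%R ->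
    s \in `[0, d]%R.
  by move=> dd; rewrite !in_itv /= => /andP[-> /le_trans]; exact.
have d1m : Num.min d1 d2 <= d1 by rewrite ge_min lexx.
have d2m : Num.min d1 d2 <= d2 by rewrite ge_min lexx orbT.
have Is s : s \in `[0, Num.min d1 d2]%R -> I (s *: 1 + t).
  move=> sd; split; last by apply: sT; exact: le_itv sd.
  move: sd; rewrite in_itv /= => /andP[s0 _].
  by rewrite addr_ge0 ?It.1//; rewrite [_ *: _]mulr1.
exists (Num.min d1 d2); first by rewrite lt_min d10.
split=> r s rd sd; rewrite pE.
- by split; [apply: sA; exact: le_itv rd|exact: Is].
- rewrite admissible_space; last exact: Is.
  apply: admissible_interior; apply: open_nbhs_nbhs; split=> //.
  by apply: sA; apply: le_itv (subset_itv_oo_cc rd).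
- apply: admissible_interior; apply: spacetime_interior.
  + by apply: sA; exact: le_itv rd.
  + exact: Is (subset_itv_oo_cc sd).
  + move: sd; rewrite in_itv /= => /andP[s0 _].
    by rewrite ltr_wpDr ?It.1//; rewrite [_ *: _]mulr1.
Qed.

(** This is [derive_inC] on the preceding square, so it also holds at [t = 0], where [dt] is
    one-sided. *)
Lemma dt_deriveC (g : V3 * R -> R) x t u : A x -> I t -> Ck_in D setT 2 g ->
  dt T (fun y r => 'D_u (fun z => g (z, r)) y) x t =
  'D_u (fun y => dt T (fun z r => g (z, r)) y t) x.
Proof.
move=> Ax It gC2; have [d d0 sq] := spacetime_two_sided_square u Ax It.
have nA y : A y -> nbhs y A by move=> Ay; exact: (open_nbhs_nbhs (conj oA Ay)).
pose gu q := derive_in D g q (u, 0); pose gt q := derive_in D g q (0, 1).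
transitivity (dt T (fun y r => gu (y, r)) x t).
  apply: dt_eq => // r Ir; rewrite /gu derive_in_space//.
  by rewrite (derive_in_interior _ _ (nA x Ax)).
rewrite -(derive_in_time T gu t Ax).
apply: etrans (derive_inC d0 sq gC2) _.
rewrite -/gt (derive_in_space A gt x u It) (derive_in_interior _ _ (nA x Ax)).
apply: near_eq_derive; apply: filterS (nA x Ax) => y Ay.
exact: derive_in_time.
Qed.

End MixedPartials.

(** * The divergence of the rate *)

Section DivergenceOfRate.
Context {R : realType}.
Notation V3 := 'cV[R]_3.
Notation M3 := 'M[R]_3.

Lemma is_deriveE {V W : normedModType R} (f : V -> W) x u df :
  is_derive x u f df -> 'D_u f x = df.
Proof. by case. Qed.

Lemma is_derive_sum_fun {V W : normedModType R} n (F : 'I_n -> V -> W)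
    (dF : 'I_n -> W) x u : (forall i, is_derive x u (F i) (dF i)) ->
  is_derive x u (fun y => \sum_i F i y) (\sum_i dF i).
Proof.
move=> FdF; have -> : (fun y => \sum_i F i y) = \sum_i F i.
  by apply/funext => y; rewrite fct_sumE.
exact: is_derive_sum.
Qed.

Lemma DivE (M : V3 -> M3) y i :
  Div M y i 0 = \sum_j 'D_(e3 j) (fun z => M z i j) y.
Proof.
rewrite mxE /div; apply: eq_bigr => j _.
have E z : (row i (M z))^T j 0 = M z i j by rewrite !mxE.
by rewrite (funext E).
Qed.

(** Since [Div] is local, an equation between matrix fields on an open set may be put under the
    divergence. *)
Lemma Div_eq (A : set V3) (M N : V3 -> M3) x : open A -> A x ->
  (forall y, A y -> M y = N y) -> Div M x = Div N x.
Proof.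
move=> oA Ax MN; apply/matrixP => i k; rewrite ord1 !DivE.
apply: eq_bigr => j _; apply: near_eq_derive.
by apply: filterS (open_nbhs_nbhs (conj oA Ax)) => y Ay; rewrite MN.
Qed.

Lemma convect_coord m n (q : V3 -> 'M[R]_(m, n)) w x i j :
  (forall u, derivable q x u) ->
  convect q w x i j = \sum_l w l 0 * 'D_(e3 l) (fun y => q y i j) x.
Proof.
move=> dq; rewrite summxE; apply: eq_bigr => l _.
by rewrite mxE derive_mx// mxE.
Qed.

(* The algebra of [div_transport], with the derivatives abstracted:
   [dV l j = d_j V_l] and [ddV i j l = d_l d_j V_i], and likewise for [s]. *)
Lemma transport_identity (V s : 'I_3 -> R) (dV ds : 'I_3 -> 'I_3 -> R)
    (ddV dds : 'I_3 -> 'I_3 -> 'I_3 -> R) :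
  (forall i j l, ddV i j l = ddV i l j) ->
  (forall i j l, dds i j l = dds i l j) ->
  \sum_j (\sum_l (V l * dds j l j + ds j l * dV l j) -
     (\sum_l (s l * ddV j l j + dV j l * ds l j) -
      ((\sum_l dV l l) * ds j j + s j * \sum_l ddV l l j))) =
  \sum_l V l * (\sum_j dds j j l) + (\sum_l dV l l) * \sum_j ds j j.
Proof.
move=> ddVC ddsC; rewrite sumrB sumrB big_split /= -mulr_sumr.
(* The double sum of [ds j l * dV l j] arises from both inner sums and cancels, and so does [s]
   times the gradient of the divergence of [V]. *)
have -> : \sum_j \sum_l (V l * dds j l j + ds j l * dV l j) =
    \sum_l V l * (\sum_j dds j j l) + \sum_j \sum_l ds j l * dV l j.
  rewrite -big_split /=; under eq_bigr => j _ do rewrite big_split /=.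
  rewrite !big_split /= exchange_big /=; congr (_ + _).
  by apply: eq_bigr => l _; rewrite mulr_sumr; apply: eq_bigr => j _; rewrite ddsC.
have -> : \sum_j \sum_l (s l * ddV j l j + dV j l * ds l j) =
    \sum_j s j * (\sum_l ddV l l j) + \sum_j \sum_l ds j l * dV l j.
  under eq_bigr => j _ do rewrite big_split /=.
  rewrite big_split /= exchange_big /=; congr (_ + _).
    by apply: eq_bigr => l _; rewrite mulr_sumr; apply: eq_bigr => j _; rewrite ddVC.
  by rewrite exchange_big; apply: eq_bigr => l _; apply: eq_bigr => j _; rewrite mulrC.
by ring.
Qed.

Variables (A : set V3) (x : V3).
Hypotheses (oA : open A) (Ax : A x).

(** The differentiated field is [curl (s x V) + (div s) V], so its divergence is that of
    [(div s) V]. Here [s] will be a row of the stress. The proof expands by the product rule and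
    uses symmetry of second derivatives. *)
Lemma div_transport (s V : 'I_3 -> V3 -> R) :
  (forall j, Ck_in A setT 2 (s j)) -> (forall j, Ck_in A setT 2 (V j)) ->
  \sum_j 'D_(e3 j) (fun y => \sum_l V l y * 'D_(e3 l) (s j) y -
     (\sum_l s l y * 'D_(e3 l) (V j) y -
      (\sum_l 'D_(e3 l) (V l) y) * s j y)) x =
  \sum_l V l x * 'D_(e3 l) (fun y => \sum_j 'D_(e3 j) (s j) y) x +
  (\sum_l 'D_(e3 l) (V l) x) * \sum_j 'D_(e3 j) (s j) x.
Proof.
move=> sC2 VC2.
have d1 (f : V3 -> R) u : Ck_in A setT 2 f -> is_derive x u f ('D_u f x).
  by move=> fC; apply: derivableP; exact: Ck_in_derivable fC Ax.
have d2 (f : V3 -> R) u w : Ck_in A setT 2 f ->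
    is_derive x u ('D_w f) ('D_u ('D_w f) x).
  move=> fC; apply: derivableP.
  exact: (Ck_in_derivable oA (Ck_in_derive oA w fC) Ax).
have dE j : is_derive x (e3 j) (fun y => \sum_l V l y * 'D_(e3 l) (s j) y -
     (\sum_l s l y * 'D_(e3 l) (V j) y -
      (\sum_l 'D_(e3 l) (V l) y) * s j y))
    (\sum_l (V l x * 'D_(e3 j) ('D_(e3 l) (s j)) x +
             'D_(e3 l) (s j) x * 'D_(e3 j) (V l) x) -
     (\sum_l (s l x * 'D_(e3 j) ('D_(e3 l) (V j)) x +
              'D_(e3 l) (V j) x * 'D_(e3 j) (s l) x) -
      ((\sum_l 'D_(e3 l) (V l) x) * 'D_(e3 j) (s j) x +
       s j x * \sum_l 'D_(e3 j) ('D_(e3 l) (V l)) x))).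
  apply: is_deriveB.
    by apply: is_derive_sum_fun => l; apply: is_deriveM; [exact: d1|exact: d2].
  apply: is_deriveB.
    by apply: is_derive_sum_fun => l; apply: is_deriveM; [exact: d1|exact: d2].
  apply: is_deriveM; last exact: d1.
  by apply: is_derive_sum_fun => l; exact: d2.
under eq_bigr => j _ do rewrite (is_deriveE (dE j)).
have hess_s l : 'D_(e3 l) (fun y => \sum_j 'D_(e3 j) (s j) y) x =
    \sum_j 'D_(e3 l) ('D_(e3 j) (s j)) x.
  by apply: is_deriveE; apply: is_derive_sum_fun => j; exact: d2.
under [in RHS]eq_bigr => l _ do rewrite hess_s.
apply: (@transport_identity (fun l => V l x) (fun l => s l x)
  (fun l j => 'D_(e3 j) (V l) x) (fun l j => 'D_(e3 j) (s l) x)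
  (fun i j l => 'D_(e3 l) ('D_(e3 j) (V i)) x)
  (fun i j l => 'D_(e3 l) ('D_(e3 j) (s i)) x)) => i j l.
  exact: deriveC oA Ax (VC2 i).
exact: deriveC oA Ax (sC2 i).
Qed.

(** [tau] stands for the time derivative of the stress at a fixed time. The terms with the skew part
    are common to both sides; the rest is [div_transport] for row [i]. *)
Lemma Div_rate (sigma tau : V3 -> M3) (v : V3 -> V3) i :
  (forall i j, Ck_in A setT 2 (fun y => sigma y i j)) ->
  (forall l, Ck_in A setT 2 (fun y => v y l 0)) ->
  (forall i j, Ck_in A setT 1 (fun y => tau y i j)) ->
  Div (fun y => tau y + convect sigma (v y) y + sigma y *m skew_part (Jac v y)
                - skew_part (Jac v y) *m sigma y) x i 0 =
  Div (fun y => sigma y *m (Jac v y)^T - div v y *: sigma y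
                + sigma y *m skew_part (Jac v y)
                - skew_part (Jac v y) *m sigma y) x i 0
  + \sum_j 'D_(e3 j) (fun y => tau y i j) x
  + \sum_l v x l 0 * 'D_(e3 l) (fun y => Div sigma y i 0) x
  + div v x * Div sigma x i 0.
Proof.
move=> sC vC tC; have AP y u (Ay : A y) := open_admissible_proper u oA Ay.
have DvC k l : Ck_in A setT 1 (fun y => Jac v y k l).
  by apply: Ck_in_eq (Ck_in_derive oA (e3 l) (vC k)) => y _; rewrite mxE.
have WC k l : Ck_in A setT 1 (fun y => skew_part (Jac v y) k l).
  apply: Ck_in_eq (Ck_inM oA (Ck_in_cst AP 1 2^-1)
    (Ck_in_linear AP (-1) (DvC k l) (DvC l k))) => y _.
  by rewrite !mxE mulN1r.
have mulC (M N : V3 -> M3) k l : (forall i j, Ck_in A setT 1 (fun y => M y i j)) ->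
    (forall i j, Ck_in A setT 1 (fun y => N y i j)) ->
    Ck_in A setT 1 (fun y => (M y *m N y) k l).
  move=> MC NC.
  apply: Ck_in_eq (Ck_in_sum AP (fun j => Ck_inM oA (MC k j) (NC j l))) => y _.
  by rewrite mxE.
have BC (f g : V3 -> R) : Ck_in A setT 1 f -> Ck_in A setT 1 g ->
    Ck_in A setT 1 (fun y => f y - g y).
  by move=> fC gC; apply: Ck_in_eq (Ck_in_linear AP (-1) fC gC) => y _;
    rewrite mulN1r.
have sC1 k l := Ck_inW (sC k l).
(* [P] is row [i] of the commutator with the skew part; [X] and [Y] below are row [i] of
   [sigma L^T - (div v) sigma] and of the convective term. *)
pose P j y := (sigma y *m skew_part (Jac v y)) i j
              - (skew_part (Jac v y) *m sigma y) i j.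
have PC j : Ck_in A setT 1 (P j) by apply: BC; exact: mulC.
have divC : Ck_in A setT 1 (div v).
  exact (Ck_in_sum AP (fun l => Ck_in_derive oA (e3 l) (vC l))).
pose X j y := \sum_l sigma y i l * 'D_(e3 l) (fun z => v z j 0) y
              - div v y * sigma y i j.
have XC j : Ck_in A setT 1 (X j).
  exact (BC _ _ (Ck_in_sum AP (fun l => Ck_inM oA (sC1 i l)
    (Ck_in_derive oA (e3 l) (vC j)))) (Ck_inM oA divC (sC1 i j))).
pose Y j y := \sum_l v y l 0 * 'D_(e3 l) (fun z => sigma z i j) y.
have YC j : Ck_in A setT 1 (Y j).
  exact (Ck_in_sum AP (fun l => Ck_inM oA (Ck_inW (vC l)) (Ck_in_derive oA (e3 l) (sC i j)))).
have nA : nbhs x A := open_nbhs_nbhs (conj oA Ax).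
have d1 (f : V3 -> R) u : Ck_in A setT 1 f -> is_derive x u f ('D_u f x).
  by move=> fC; apply: derivableP; exact: Ck_in_derivable fC Ax.
have DivY : Div (fun y => tau y + convect sigma (v y) y + sigma y *m skew_part (Jac v y)
                - skew_part (Jac v y) *m sigma y) x i 0 =
    \sum_j ('D_(e3 j) (fun y => tau y i j) x + 'D_(e3 j) (Y j) x + 'D_(e3 j) (P j) x).
  rewrite DivE; apply: eq_bigr => j _.
  rewrite -(is_deriveE (is_deriveD (is_deriveD (d1 _ (e3 j) (tC i j))
    (d1 _ (e3 j) (YC j))) (d1 _ (e3 j) (PC j)))).
  apply: near_eq_derive; apply: filterS nA => y Ay.
  rewrite !mxE convect_coord; last first.
    by move=> u; apply/derivable_mxP => k l; exact: (Ck_in_derivable oA (sC k l) Ay).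
  by rewrite -[RHS]/(tau y i j + Y j y + P j y) /P !mxE addrA.
have DivX : Div (fun y => sigma y *m (Jac v y)^T - div v y *: sigma y
                + sigma y *m skew_part (Jac v y)
                - skew_part (Jac v y) *m sigma y) x i 0 =
    \sum_j ('D_(e3 j) (X j) x + 'D_(e3 j) (P j) x).
  rewrite DivE; apply: eq_bigr => j _.
  rewrite -(is_deriveE (is_deriveD
    (d1 _ (e3 j) (XC j)) (d1 _ (e3 j) (PC j)))).
  apply: near_eq_derive; apply: filterS nA => y Ay.
  rewrite -[RHS]/(X j y + P j y) /X /P !mxE -addrA; congr (_ - _ + _).
  by apply: eq_bigr => l _; rewrite !mxE.
have DivS : (fun y => Div sigma y i 0) =
    (fun y => \sum_j 'D_(e3 j) (fun z => sigma z i j) y).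
  by apply/funext => y; exact: DivE.
have YX : \sum_j ('D_(e3 j) (Y j) x - 'D_(e3 j) (X j) x) =
    \sum_l v x l 0 * 'D_(e3 l) (fun y => Div sigma y i 0) x
    + div v x * Div sigma x i 0.
  rewrite DivS DivE; apply: etrans (div_transport (fun j => sC i j) vC).
  apply: eq_bigr => j _; apply/esym.
  exact: is_deriveE (is_deriveB (d1 _ (e3 j) (YC j)) (d1 _ (e3 j) (XC j))).
have split_sums (a b c d : 'I_3 -> R) (e f : R) : \sum_j (b j - d j) = e + f ->
    \sum_j (a j + b j + c j) = \sum_j (d j + c j) + \sum_j a j + e + f.
  by rewrite sumrB !big_split /= -(addrA _ e) => <-; ring.
by rewrite DivY DivX; exact: split_sums YX.
Qed.

End DivergenceOfRate.

(** * Transport along trajectories *)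

Section Flow.
Context {R : realType}.
Notation V3 := 'cV[R]_3.
Notation M3 := 'M[R]_3.

Lemma det3E (M : M3) : \det M =
  M 0 0 * (M 1 1 * M 2 2 - M 1 2 * M 2 1) -
  M 0 1 * (M 1 0 * M 2 2 - M 1 2 * M 2 0) +
  M 0 2 * (M 1 0 * M 2 1 - M 1 1 * M 2 0).
Proof.
(* Entries are indexed by natural numbers so that equal ordinals built differently become identical
   for [ring]. *)
pose m (a b : nat) := M (inord a) (inord b).
have mE i j : M i j = m i j by rewrite /m !inord_val.
rewrite (expand_det_row _ ord0) !big_ord_recl big_ord0 /cofactor.
rewrite !(expand_det_row _ ord0) !big_ord_recl !big_ord0 /cofactor !det_mx11.
rewrite !mxE !mE /= /bump /= ?modn_small//.
by rewrite !expr0 !expr1 ?sqrrN ?expr1n; ring.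
Qed.

(** Jacobi's formula for [F' = L F]; in dimension three it is a polynomial identity once the
    determinant is expanded. *)
Lemma is_derive_det (F : R -> M3) (L : M3) (t : R) :
  (forall i j, is_derive t (1 : R) (fun r => F r i j) ((L *m F t) i j)) ->
  is_derive t (1 : R) (fun r => \det (F r)) (\tr L * \det (F t)).
Proof.
move=> dF; pose a i j := fun r => F r i j.
have -> : (fun r => \det (F r)) =
    a 0 0 * (a 1 1 * a 2 2 - a 1 2 * a 2 1) -
    a 0 1 * (a 1 0 * a 2 2 - a 1 2 * a 2 0) +
    a 0 2 * (a 1 0 * a 2 1 - a 1 1 * a 2 0).
  by apply/funext => r; rewrite det3E.
have da i j : is_derive t (1 : R) (a i j) ((L *m F t) i j) by exact: dF.
refine (is_derive_eq (is_deriveD (is_deriveB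
  (is_deriveM (da 0 0) (is_deriveB (is_deriveM (da _ _) (da _ _))
    (is_deriveM (da _ _) (da _ _))))
  (is_deriveM (da 0 1) (is_deriveB (is_deriveM (da _ _) (da _ _))
    (is_deriveM (da _ _) (da _ _)))))
  (is_deriveM (da 0 2) (is_deriveB (is_deriveM (da _ _) (da _ _))
    (is_deriveM (da _ _) (da _ _))))) _).
have o1 : lift ord0 ord0 = 1 :> 'I_3 by exact: val_inj.
have o2 : lift ord0 (lift ord0 ord0) = 2 :> 'I_3 by exact: val_inj.
have o0 : ord0 = 0 :> 'I_3 by exact: val_inj.
rewrite det3E /mxtrace !mxE !big_ord_recl !big_ord0 !o2 !o1 !o0.
rewrite /a /GRing.scale /= !fctE.
ring.
Qed.

End Flow.

Section Trajectories.
Context {R : realType}.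
Notation V3 := 'cV[R]_3.
Variable T : \bar R.
Notation I := (time_interval T).

Lemma time_admissible_proper t : I t -> ProperFilter (admissible I t (1 : R)).
Proof.
move=> It; rewrite -(@admissible_time _ setT T 0 t)//.
by apply: spacetime_admissible_proper => //; exact: openT.
Qed.

Lemma dt_coord m n (q : V3 -> R -> 'M[R]_(m, n)) x t i j :
  I t -> derivable_in I (q x) t 1 ->
  dt T (fun y r => q y r i j) x t = dt T q x t i j.
Proof.
by move=> It dq; exact: (derive_in_coord i j (time_admissible_proper It) dq).2.
Qed.

Lemma continuous_slice (x : V3) : continuous (fun r : R => (x, r)).
Proof.
move=> r; exact: (@cvg_pair _ _ _ (nbhs r) (nbhs x) (nbhs r) _ _ _ (fun=> x) id
  (cvg_cst x) cvg_id).
Qed.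

Lemma is_derive_time {W : normedModType R} (C : set V3) (g : V3 * R -> W) x t :
  C x -> I t -> 0 < t -> Ck_in (C `*` I) setT 1 g ->
  is_derive t (1 : R) (fun r => g (x, r)) (dt T (fun y r => g (y, r)) x t).
Proof.
move=> Cx It t0 [_ /(_ (0, 1) Logic.I)[dg _]].
have := dg (x, t) (conj Cx It); rewrite derivable_in_time//.
have nI := time_interval_interior It t0.
rewrite derivable_in_interior// => dgt; split => //.
by rewrite /dt derive_in_interior.
Qed.

(** The curve [(p r, r)] has velocity [(w, 1)]; splitting it along the space basis and time gives
    the convective term and the time derivative. *)
Lemma is_derive_spacetime_curve (B : set V3) (g : V3 * R -> R) (p : R -> V3) t w :
  open B -> B (p t) -> I t -> 0 < t -> is_derive t (1 : R) p w ->
  Ck_in (B `*` I) setT 1 g ->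
  is_derive t (1 : R) (fun r => g (p r, r))
    (\sum_l w l 0 * 'D_(e3 l) (fun y => g (y, t)) (p t)
     + dt T (fun y r => g (y, r)) (p t) t).
Proof.
move=> oB Bp It t0 dp gC1.
have nD : nbhs (p t, t) (B `*` I) by exact: spacetime_interior.
have dg := Ck1_differentiable_spacetime nD gC1.
have dpt : is_derive t (1 : R) (fun r => (p r, r) : V3 * R) (w, 1).
  have dp' : differentiable p t by apply/derivable1_diffP; case: dp.
  split; first by apply/derivable1_diffP; exact: differentiable_pair.
  rewrite deriveE; last exact: differentiable_pair.
  rewrite diff_pair//= -!deriveE// derive_id.
  by case: dp => _ ->.
apply: is_derive_eq (is_derive_comp_diff dpt dg) _.
rewrite deriveE//.
have -> : (w, 1) = \sum_l w l 0 *: ((e3 l, 0) : V3 * R) + (0, 1).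
  apply: injective_projections => /=.
    rewrite addr0 (big_morph fst (id1 := 0) (op1 := +%R))//= sum_e3//.
  rewrite (big_morph snd (id1 := 0) (op1 := +%R))//= big1 ?add0r// => l _.
  exact: mulr0.
rewrite linearD linear_sum /=; congr (_ + _); last first.
  by rewrite -deriveE// -(derive_in_interior _ _ nD) derive_in_time.
apply: eq_bigr => l _; rewrite linearZ /= -deriveE//.
rewrite -(derive_in_interior _ _ nD) derive_in_space//.
by rewrite (derive_in_interior _ _ (open_nbhs_nbhs (conj oB Bp))).
Qed.

(** The left-hand side of the continuity equation for a density [h] carried by [v]. *)
Definition balance (v : V3 -> R -> V3) (h : V3 * R -> R) y t : R :=
  dt T (fun z r => h (z, r)) y t
  + \sum_l v y t l 0 * 'D_(e3 l) (fun z => h (z, t)) y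
  + div (v ^~ t) y * h (y, t).

Lemma balance_eq (B : set V3) v (g h : V3 * R -> R) y t : open B ->
  B y -> I t -> {in B `*` I, g =1 h} -> balance v g y t = balance v h y t.
Proof.
move=> oB By It gh; rewrite /balance.
have ghE z r : B z -> I r -> g (z, r) = h (z, r).
  by move=> Bz Ir; apply: gh; rewrite inE.
rewrite ghE// (@dt_eq _ T _ (fun z r => g (z, r)) (fun z r => h (z, r)))//; last first.
  by move=> r; exact: ghE.
congr (_ + _ + _); apply: eq_bigr => l _; congr (_ * _).
apply: near_eq_derive; apply: filterS (open_nbhs_nbhs (conj oB By)) => z Bz.
exact: ghE.
Qed.

Lemma balance_linear (B : set V3) v (g h : V3 * R -> R) a y t : open B ->
  B y -> I t -> Ck_in (B `*` I) setT 1 g -> Ck_in (B `*` I) setT 1 h ->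
  balance v (fun p => g p + a * h p) y t =
  balance v g y t + a * balance v h y t.
Proof.
move=> oB By It [_ dg] [_ dh]; rewrite /balance.
have DP p u (Dp : (B `*` I) p) := spacetime_proper u oB Dp.
have Dyt : (B `*` I) (y, t) by [].
have nB : nbhs y B := open_nbhs_nbhs (conj oB By).
have lin u := (derive_in_linear DP a Dyt
  ((dg u Logic.I).1 _ Dyt) ((dh u Logic.I).1 _ Dyt)).2.
have dtE (k : V3 * R -> R) := derive_in_time T k t By.
have DE (k : V3 * R -> R) u : derive_in (B `*` I) k (y, t) (u, 0) =
    'D_u (fun z => k (z, t)) y.
  by rewrite derive_in_space// (derive_in_interior _ _ nB).
rewrite -(dtE (fun p => g p + a * h p)) -(dtE g) -(dtE h) lin.
under eq_bigr => l _ do rewrite -(DE (fun p => g p + a * h p)) lin !DE mulrDr mulrCA.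
rewrite big_split -mulr_sumr /=; ring.
Qed.

Variables (A B : set V3) (phi v : V3 -> R -> V3).
Hypotheses (oA : open A) (oB : open B).
Hypothesis phiC : smooth_spacetime A T phi.
Hypothesis phiB : forall x t, A x -> I t -> B (phi x t).
Hypothesis v_velocity : forall x t, A x -> I t -> v (phi x t) t = dt T phi x t.

Let phi_coordC i k : Ck_in (A `*` I) setT k (fun p => phi p.1 p.2 i 0).
Proof. exact: smooth_spacetime_coord. Qed.

Let nA x : A x -> nbhs x A.
Proof. by move=> Ax; exact: (open_nbhs_nbhs (conj oA Ax)). Qed.

Let derivable_phi x t u : A x -> I t -> derivable (phi ^~ t) x u.
Proof.
move=> Ax It; have := Ck_in_space It (phiC 1) => -[_ /(_ u Logic.I)[dphi _]].
by rewrite -(derivable_in_interior _ _ (nA Ax)); exact: dphi.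
Qed.

(** The matrix [F = D phi] satisfies [F' = L F] with [L] the velocity gradient: exchange [d_t] and
    [d_j], then apply the chain rule to [v (phi y t) t]. Jacobi's formula concludes. *)
Lemma is_derive_det_flow x t : A x -> I t -> 0 < t ->
  (forall i, Ck_in B setT 1 (fun y => v y t i 0)) ->
  is_derive t (1 : R) (fun r => \det (Jac (phi ^~ r) x))
    (div (v ^~ t) (phi x t) * \det (Jac (phi ^~ t) x)).
Proof.
move=> Ax It t0 vC.
have -> : div (v ^~ t) (phi x t) = \tr (Jac (v ^~ t) (phi x t)).
  by rewrite /div /mxtrace; apply: eq_bigr => i _; rewrite mxE.
apply: is_derive_det => i j.
have entry r : Jac (phi ^~ r) x i j = 'D_(e3 j) (fun y => phi y r i 0) x.
  by rewrite mxE.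
rewrite (funext entry).
(* Unlike the Jacobian entry, [G] is a derivative relative to spacetime, so the smoothness of [phi]
   applies to it directly. *)
pose G p := derive_in (A `*` I) (fun p => phi p.1 p.2 i 0) p (e3 j, 0).
have GE r : I r -> G (x, r) = 'D_(e3 j) (fun y => phi y r i 0) x.
  by move=> Ir; rewrite /G derive_in_space// (derive_in_interior _ _ (nA Ax)).
have [_ /(_ (e3 j, 0) Logic.I)[_ GC]] := phi_coordC i 2.
have dG := is_derive_time Ax It t0 GC.
have nI := time_interval_interior It t0.
have near_GE : \forall r \near t, G (x, r) = 'D_(e3 j) (fun y => phi y r i 0) x.
  by apply: filterS nI => r Ir; exact: GE.
apply: near_eq_is_derive near_GE _; apply: is_derive_eq dG _.
transitivity (dt T (fun y r => 'D_(e3 j) (fun z => phi z r i 0) y) x t).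
  exact: dt_eq GE It.
rewrite (dt_deriveC oA (e3 j) Ax It (phi_coordC i 2)).
transitivity ('D_(e3 j) (fun y => v (phi y t) t i 0) x).
  apply: near_eq_derive; apply: filterS (nA Ax) => y Ay.
  rewrite v_velocity// dt_coord//.
  have [_ /(_ (0, 1) Logic.I)[dphi _]] := phiC 1.
  by have := dphi (y, t) (conj Ay It); rewrite derivable_in_time.
have dv : differentiable (fun z => v z t i 0) (phi x t).
  exact: Ck1_differentiable (open_nbhs_nbhs (conj oB (phiB Ax It))) (vC i).
have dphi : derivable (phi ^~ t) x (e3 j) by exact: derivable_phi.
apply: etrans (derive_comp_coord dphi dv) _.
rewrite mxE; apply: eq_bigr => l _; rewrite !mxE mulrC; congr (_ * _).
by rewrite derive_mx ?mxE//; exact: derivable_phi.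
Qed.

(** Derivatives along trajectories are computed at positive times only; continuity up to [0] lets
    the mean value theorem start at the initial time. *)
Lemma within_continuous_det_flow x : A x ->
  {within I, continuous (fun r => \det (Jac (phi ^~ r) x))}.
Proof.
move=> Ax.
have cJ i j : {within I, continuous (fun r => Jac (phi ^~ r) x i j)}.
  pose G p := derive_in (A `*` I) (fun p => phi p.1 p.2 i 0) p (e3 j, 0).
  have cx : {within I, continuous (fun r => G (x, r))}.
    have [_ /(_ (e3 j, 0) Logic.I)[_ [cG _]]] := phi_coordC i 1.
    apply: (@continuous_comp_within R (V3 * R)%type R I (A `*` I)
      (fun r => (x, r)) G _ _ cG) => //.
    by apply: continuous_subspaceT; exact: continuous_slice.
  apply: (@subspace_eq_continuous R I R (fun r => G (x, r))
    (fun r => Jac (phi ^~ r) x i j) _ cx) => r; rewrite inE => Ir.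
  by rewrite [RHS]mxE /G derive_in_space// (derive_in_interior _ _ (nA Ax)).
rewrite (funext (fun r => det3E (Jac (phi ^~ r) x))).
apply/subspace_continuousP => r Ir.
have c i j := (subspace_continuousP _ _).1 (cJ i j) r Ir.
by apply: cvgD; [apply: cvgB|]; (apply: cvgM; first exact: c);
  apply: cvgB; apply: cvgM; exact: c.
Qed.

Hypothesis phi_onto : forall y t, B y -> I t -> exists2 x, A x & phi x t = y.
Hypothesis phi_det : forall x t, A x -> I t -> 0 < \det (Jac (phi ^~ t) x).
Hypothesis vC1 : forall t i, I t -> Ck_in B setT 1 (fun y => v y t i 0).

(* Along a trajectory, [det (D phi)] times the density [h] is constant. *)
Lemma continuity_equation_zero (h : V3 * R -> R) :
  Ck_in (B `*` I) setT 1 h ->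
  (forall y t, B y -> I t -> balance v h y t = 0) ->
  (forall y, B y -> h (y, 0) = 0) ->
  forall y t, B y -> I t -> h (y, t) = 0.
Proof.
move=> hC h_eq h0 y t By It.
have [x Ax xy] := phi_onto By It; rewrite -xy.
have Ir r : r \in `[0, t]%R -> I r.
  rewrite in_itv /= => /andP[r0 rt]; split => //.
  by apply: le_lt_trans It.2; rewrite lee_fin.
pose J r := \det (Jac (phi ^~ r) x).
pose m r := J r * h (phi x r, r).
have I0 : I 0 by apply: Ir; rewrite in_itv /= lexx; case: It.
(* The mean value theorem needs a nondegenerate interval; [t = 0] is the initial condition
   itself. *)
have [t0|tn0] := ltP 0 t; last first.
  have -> : t = 0 by apply/eqP; rewrite eq_le tn0; case: It.
  by apply: h0; exact: phiB.
have dm r : r \in `]0, t[%R -> is_derive r (1 : R) m 0.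
  move=> rt; have Irt := Ir r (subset_itv_oo_cc rt).
  have r0 : 0 < r by move: rt; rewrite in_itv /= => /andP[].
  have Bp := phiB Ax Irt.
  have dJ := is_derive_det_flow Ax Irt r0 (fun i => vC1 i Irt).
  have dphi := is_derive_time Ax Irt r0 (phiC 1).
  have dh := is_derive_spacetime_curve oB Bp Irt r0 dphi hC.
  apply: is_derive_eq (is_deriveM dJ dh) _.
  (* The continuity equation makes the derivative of [h] along the trajectory equal to
     [- (div v) h], which cancels the growth of [J]. *)
  have := h_eq _ _ Bp Irt; rewrite /balance v_velocity// => /eqP.
  rewrite addr_eq0 addrC => /eqP ->.
  by rewrite -/(J r) /GRing.scale /=; ring.
have cm : {within `[0, t], continuous m}.
  have cJ : {within `[0, t], continuous J}.
    by apply: continuous_subspaceW (within_continuous_det_flow Ax) => r; exact: Ir.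
  have ch : {within `[0, t], continuous (fun r => h (phi x r, r))}.
    have [chD _] := hC; have [cphi _] := phiC 0.
    apply: (@continuous_comp_within R (V3 * R)%type R `[0, t]%classic (B `*` I)
      (fun r => (phi x r, r)) h _ _ chD).
      by move=> r /Ir Irt; split => //; exact: phiB.
    have cp : {within `[0, t], continuous (phi x)}.
      apply: (@continuous_comp_within R (V3 * R)%type V3 `[0, t]%classic (A `*` I)
        (fun r => (x, r)) (fun p => phi p.1 p.2) _ _ cphi).
        by move=> r /Ir.
      by apply: continuous_subspaceT; exact: continuous_slice.
    move/subspace_continuousP : cp => cp; apply/subspace_continuousP => r rt.
    exact: (@cvg_pair _ _ _ _ (nbhs (phi x r)) (nbhs r) _ _ _ _ id (cp r rt)
      (cvg_within _)).
  move/subspace_continuousP : cJ => cJ; move/subspace_continuousP : ch => ch.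
  by apply/subspace_continuousP => r rt; apply: cvgM; [exact: cJ|exact: ch].
have [r _] := MVT t0 dm cm; rewrite mul0r => /eqP; rewrite subr_eq0 => /eqP m0.
have : m t = 0 by rewrite m0 /m h0 ?mulr0//; exact: phiB.
move/eqP; rewrite mulf_eq0 => /orP[/eqP J0|/eqP//].
by have := phi_det Ax It; rewrite -/(J t) J0 ltxx.
Qed.

End Trajectories.

(** * Smoothness of the velocity; balance laws for stress divergence and force *)

Section Kinematics.
Context {R : realType}.
Notation V3 := 'cV[R]_3.
Notation M3 := 'M[R]_3.
Variable T : \bar R.
Notation I := (time_interval T).

Lemma Ck_in_dt m n (B : set V3) (q : V3 -> R -> 'M[R]_(m, n)) t k i j :
  open B -> smooth_spacetime B T q -> I t ->
  Ck_in B setT k (fun y => dt T q y t i j).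
Proof.
move=> oB qC It; have [_ /(_ (0, 1) Logic.I)[_ dqC]] := qC k.+1.
apply: Ck_in_eq (Ck_in_coord i j _ (Ck_in_space It dqC)) => [y|y u By _].
  by rewrite inE => By; rewrite derive_in_time.
exact: open_admissible_proper.
Qed.

(** On [B], [v ^~ t] is [dt T phi] at time [t] composed with the inverse [psi] of the motion, and
    both are smooth. *)
Lemma velocity_smooth (A B : set V3) (phi v : V3 -> R -> V3) t i k :
  open A -> open B -> smooth_spacetime A T phi ->
  diffeomorphism A B (phi ^~ t) ->
  (forall x, A x -> v (phi x t) t = dt T phi x t) -> I t ->
  Ck_in B setT k (fun y => v y t i 0).
Proof.
move=> oA oB phiC [_ [psi [psiC _ psiK]]] vE It.
have BA y (By : B y) : A (psi y) := (psiK y By).1.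
apply: Ck_in_eq (Ck_in_comp oB oA BA (psiC k) (Ck_in_dt k i 0 oA phiC It)) => y.
rewrite inE => By; have [Apsi psiE] := psiK y By.
by rewrite -vE// psiE.
Qed.

Variables (B : set V3) (sigma : V3 -> R -> M3).
Hypotheses (oB : open B) (sigmaC : smooth_spacetime B T sigma).

(** Written with derivatives relative to spacetime, so that smoothness up to [t = 0] is inherited
    from [sigma]; on [B] and at admissible times it agrees with [Div]. *)
Definition Div_spacetime i (p : V3 * R) : R :=
  \sum_j derive_in (B `*` I) (fun q => sigma q.1 q.2 i j) p (e3 j, 0).

Let nB y : B y -> nbhs y B.
Proof. by move=> By; exact: (open_nbhs_nbhs (conj oB By)). Qed.

Let DP p u (Dp : (B `*` I) p) := spacetime_proper u oB Dp.

Lemma Div_spacetimeE i y t : B y -> I t ->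
  Div_spacetime i (y, t) = Div (sigma ^~ t) y i 0.
Proof.
move=> By It; rewrite DivE; apply: eq_bigr => j _.
by rewrite derive_in_space// (derive_in_interior _ _ (nB By)).
Qed.

Let partialC i j k : Ck_in (B `*` I) setT k
  (fun p => derive_in (B `*` I) (fun q => sigma q.1 q.2 i j) p (e3 j, 0)).
Proof.
by have [_ /(_ (e3 j, 0) Logic.I)[]] := smooth_spacetime_coord i j k.+1 oB sigmaC.
Qed.

Lemma Ck_in_Div_spacetime i k : Ck_in (B `*` I) setT k (Div_spacetime i).
Proof. exact: (Ck_in_sum DP (fun j => partialC i j k)). Qed.

(** Divergence and time derivative commute, entry by entry, by [dt_deriveC]. *)
Lemma sum_derive_dt i y t : B y -> I t ->
  \sum_j 'D_(e3 j) (fun z => dt T sigma z t i j) y =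
  dt T (fun z r => Div_spacetime i (z, r)) y t.
Proof.
move=> By It; rewrite -(derive_in_time T (Div_spacetime i) t By).
have Dyt : (B `*` I) (y, t) by [].
have dpartial j := ((partialC i j 1).2 (0, 1) Logic.I).1 (y, t) Dyt.
rewrite (derive_in_sum DP Dyt dpartial).2; apply: eq_bigr => j _.
rewrite derive_in_time//.
transitivity ('D_(e3 j) (fun z => dt T (fun x r => sigma x r i j) z t) y).
  apply: near_eq_derive; apply: filterS (nB By) => z Bz.
  rewrite dt_coord//; have [_ /(_ (0, 1) Logic.I)[dsigma _]] := sigmaC 1.
  by have := dsigma (z, t) (conj Bz It); rewrite derivable_in_time.
rewrite -(dt_deriveC oB (e3 j) By It (smooth_spacetime_coord i j 2 oB sigmaC)).
apply: dt_eq => // r Ir.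
by rewrite derive_in_space// (derive_in_interior _ _ (nB By)).
Qed.

(** In [Div_rate] with [tau] the time derivative of [sigma], the three extra terms assemble into the
    continuity operator applied to the divergence of [sigma]. *)
Lemma Div_rate_balance (v : V3 -> R -> V3) y t i : B y -> I t ->
  (forall l, Ck_in B setT 2 (fun z => v z t l 0)) ->
  Div (fun z => dt T sigma z t + convect (sigma ^~ t) (v z t) z
                + sigma z t *m skew_part (Jac (v ^~ t) z)
                - skew_part (Jac (v ^~ t) z) *m sigma z t) y i 0 =
  Div (fun z => sigma z t *m (Jac (v ^~ t) z)^T - div (v ^~ t) z *: sigma z t
                + sigma z t *m skew_part (Jac (v ^~ t) z)
                - skew_part (Jac (v ^~ t) z) *m sigma z t) y i 0
  + balance T v (Div_spacetime i) y t.
Proof.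
move=> By It vC.
have sC k l : Ck_in B setT 2 (fun z => sigma z t k l).
  exact: (Ck_in_space It (smooth_spacetime_coord k l 2 oB sigmaC)).
have tC k l : Ck_in B setT 1 (fun z => dt T sigma z t k l) by exact: Ck_in_dt.
apply: etrans (Div_rate oB By i sC vC tC) _.
rewrite sum_derive_dt// /balance -!addrA; congr (_ + (_ + _)).
rewrite -Div_spacetimeE//; congr (_ + _).
apply: eq_bigr => l _; congr (_ * _); apply: near_eq_derive.
by apply: filterS (nB By) => z Bz; rewrite Div_spacetimeE.
Qed.

(** Recognizes the force terms of the second system as the continuity operator applied to [f]. *)
Lemma balance_coord (v f : V3 -> R -> V3) y t i : B y -> I t ->
  smooth_spacetime B T f ->
  balance T v (fun p => f p.1 p.2 i 0) y t =
  (div (v ^~ t) y *: f y t + convect (f ^~ t) (v y t) y + dt T f y t) i 0.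
Proof.
move=> By It fC; have [_ df] := fC 1.
have dspace u : derivable (f ^~ t) y u.
  rewrite -(derivable_in_interior _ _ (nB By)).
  exact: (((Ck_in_space It (fC 1)).2 u Logic.I).1 y By).
have dtime : derivable_in I (f y) t 1.
  have := (df (0, 1) Logic.I).1 (y, t) (conj By It).
  by rewrite derivable_in_time.
have expand (a b c : V3) : (a + b + c) i 0 = a i 0 + b i 0 + c i 0.
  by rewrite !mxE.
rewrite expand convect_coord// -(dt_coord i 0 It dtime) mxE.
have rev3 (a b c : R) : a + b + c = c + b + a by ring.
exact: rev3.
Qed.

End Kinematics.

(** * Equivalence of the two systems *)

Theorem mainTheorem1 (R : realType) (Omega Omega_xi : set 'cV[R]_3) (T : \bar R)
    (phi v f : 'cV[R]_3 -> R -> 'cV[R]_3)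
    (sigma : 'cV[R]_3 -> R -> 'M[R]_3)
    (H : 'M[R]_3 -> 'M[R]_3 -> 'M[R]_3)
    (Omega_domain : is_domain Omega)
    (Omega_xi_domain : is_domain Omega_xi)
    (T_gt0 : (0%:E < T)%E)
    (phi_smooth : smooth_spacetime Omega T phi)
    (phi_diffeo : forall t, time_interval T t ->
       diffeomorphism Omega Omega_xi (phi ^~ t))
    (phi_det : forall x t, Omega x -> time_interval T t ->
       0 < \det (Jac (phi ^~ t) x))
    (v_velocity : forall x t, Omega x -> time_interval T t ->
       v (phi x t) t = dt T phi x t)
    (f_smooth : smooth_spacetime Omega_xi T f)
    (sigma_sym : forall xi t, Omega_xi xi -> time_interval T t ->
       Sym3 (sigma xi t))
    (sigma_smooth : smooth_spacetime Omega_xi T sigma)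
    (H_lin : Lin_Sym3_valued H)
    (H_smooth : smooth_Lin_Sym3 H)
    (initial_equilibrium : forall xi, Omega_xi xi ->
       Div (sigma ^~ 0) xi = f xi 0) :
  (forall xi t, Omega_xi xi -> time_interval T t ->
     ZJ_rate T v sigma xi t = H (sigma xi t) (sym_part (Jac (v ^~ t) xi)) /\
     Div (sigma ^~ t) xi = f xi t)
  <->
  (forall xi t, Omega_xi xi -> time_interval T t ->
     dt T sigma xi t + convect (sigma ^~ t) (v xi t) xi
       + sigma xi t *m skew_part (Jac (v ^~ t) xi)
       - skew_part (Jac (v ^~ t) xi) *m sigma xi t
     = H (sigma xi t) (sym_part (Jac (v ^~ t) xi)) /\
     Div (fun y => H (sigma y t) (sym_part (Jac (v ^~ t) y))) xi
     = Div (fun y => sigma y t *m (Jac (v ^~ t) y)^T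
                     - div (v ^~ t) y *: sigma y t
                     + sigma y t *m skew_part (Jac (v ^~ t) y)
                     - skew_part (Jac (v ^~ t) y) *m sigma y t) xi
       + div (v ^~ t) xi *: f xi t
       + convect (f ^~ t) (v xi t) xi
       + dt T f xi t).
Proof.
have [oA _ _] := Omega_domain; have [oB _ _] := Omega_xi_domain.
have phi_maps x t : Omega x -> time_interval T t -> Omega_xi (phi x t).
  by move=> Ax It; have [_ [psi [_ + _]]] := phi_diffeo t It; case/(_ x Ax).
have phi_onto y t : Omega_xi y -> time_interval T t ->
    exists2 x, Omega x & phi x t = y.
  move=> By It; have [_ [psi [_ _ /(_ y By)[Apsi psiE]]]] := phi_diffeo t It.
  by exists (psi y).
have vC t i k : time_interval T t -> Ck_in Omega_xi setT k (fun y => v y t i 0).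
  move=> It; apply: (velocity_smooth i k oA oB phi_smooth (phi_diffeo t It) _ It).
  by move=> x Ax; exact: v_velocity.
have SC i := Ck_in_Div_spacetime oB sigma_smooth i 1.
have fC i := smooth_spacetime_coord i 0 1 oB f_smooth.
have rate xi t i (Bxi : Omega_xi xi) (It : time_interval T t) :=
  Div_rate_balance oB sigma_smooth i Bxi It (fun l => vC t l 2 It).
have fE xi t i (Bxi : Omega_xi xi) (It : time_interval T t) :=
  balance_coord oB v i Bxi It f_smooth.
have split4 (a b c d : 'cV[R]_3) i : (a + b + c + d) i 0 = a i 0 + (b + c + d) i 0.
  by rewrite !mxE !addrA.
split=> sys xi t Bxi It.
  (* [ZJ_rate] unfolds to the left-hand side of the rate equation in the second system, so [zj]
     serves for both. *)
  have [zj _] := sys xi t Bxi It; split; first exact: zj.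
  (* The rate equation holds throughout [Omega_xi] at time [t], so the divergence of its right-hand
     side may be computed from the rate. *)
  rewrite -(Div_eq oB Bxi (fun y By => (sys y t By It).1)).
  apply/matrixP => i k; rewrite ord1; apply: etrans (rate xi t i Bxi It) _.
  rewrite split4 -fE//; congr (_ + _).
  (* Equilibrium identifies the two densities on all of spacetime, hence also their balances. *)
  apply: (balance_eq v oB Bxi It) => -[y r]; rewrite inE => -[/= By Ir].
  by rewrite Div_spacetimeE// (sys y r By Ir).2.
have [zj _] := sys xi t Bxi It; split; first exact: zj.
apply/matrixP => i k; rewrite ord1 -(Div_spacetimeE sigma oB i Bxi It).
apply/subr0_eq.
(* Component [i] of the residual [Div sigma - f], to be shown to vanish by the continuity
   equation. *)
pose h p := Div_spacetime T Omega_xi sigma i p + -1 * f p.1 p.2 i 0.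
have DP p u (Dp : (Omega_xi `*` time_interval T) p) := spacetime_proper u oB Dp.
have hC : Ck_in (Omega_xi `*` time_interval T) setT 1 h.
  exact: (Ck_in_linear DP (-1) (SC i) (fC i)).
have h_balance y r : Omega_xi y -> time_interval T r -> balance T v h y r = 0.
  move=> By Ir; rewrite (balance_linear v (-1) oB By Ir (SC i) (fC i)) fE//.
  have [_ sys2] := sys y r By Ir.
  rewrite -(Div_eq oB By (fun z Bz => (sys z r Bz Ir).1)) in sys2.
  (* The divergence term common to both sides cancels, leaving equality of the balances of
     [Div sigma] and [f]. *)
  have := congr1 (fun M : 'cV[R]_3 => M i 0) sys2; rewrite rate// split4 => /addrI ->.
  by rewrite mulN1r subrr.
have h0 y : Omega_xi y -> h (y, 0) = 0.
  move=> By; have I0 : time_interval T 0 by split.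
  by rewrite /h Div_spacetimeE//= initial_equilibrium// mulN1r subrr.
rewrite -mulN1r.
exact: (continuity_equation_zero oA oB phi_smooth phi_maps v_velocity phi_onto
  phi_det (fun t i It => vC t i 1 It) hC h_balance h0 Bxi It).
Qed.
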